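(* Let $K/\mathbb{Q}$ be a number field with ring of integers $\mathcal{O}_K$, let $H>0$ be a constant, and let $A$ be a finite set of elements of $\mathcal{O}_K$ such that $H(a)\le H$ for all $a\in A$, where $H(\cdot)$ denotes the multiplicative height on $K$. Let $P$ be a finite set of prime ideals in $\mathcal{O}_K$. If $|A \bmod \mathfrak{p}|\le \nu(\mathfrak{p})$ for all $\mathfrak{p}\in P$, then $$|A|\ll_K\left(\frac{\sum_{\mathfrak{p}\in P}\log N\mathfrak{p}-\log(2C_KH)}{\sum_{\mathfrak{p}\in P}\frac{\log N\mathfrak{p}}{\nu(\mathfrak{p})}-\log(2C_KH)}\right)(\log H)^r,$$ where $C_K$ is a constant depending only on the number field $K$, $r$ is the rank of the unit group $\mathcal{O}_K^*$, and provided that the denominator in this expression is positive.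
   Context: For a number field $K$, let $M_K$ be its set of places. For an Archimedean place $v$ associated with an embedding $\sigma:K\to\mathbb{C}$, $|\alpha|_v=|\sigma(\alpha)|$ (usual absolute value). For a non-Archimedean place $v$ associated with a prime ideal $\mathfrak{p}$ above the rational prime $p$, $|\alpha|_v=p^{-v_{\mathfrak{p}}(\alpha)/e_{\mathfrak{p}}}$, where $v_{\mathfrak{p}}(\alpha)$ is the exponent of $\mathfrak{p}$ in the factorization of $\alpha\mathcal{O}_K$ and $e_{\mathfrak{p}}$ is the ramification index of $\mathfrak{p}$ over $p$ (and $|0|_v=0$). Put $n_v=[K_v:\mathbb{Q}_v]$, where $K_v$ is the completion of $K$ at $v$. The multiplicative height of $\alpha\in K$ (relative to $K$, not normalized by the degree) is $H(\alpha)=\prod_{v\in M_K}\max(1,|\alpha|_v^{n_v})$. For a prime ideal $\mathfrak{p}$, $N\mathfrak{p}=|\mathcal{O}_K/\mathfrak{p}|$. The notation $|A\bmod\mathfrak{p}|$ is the number of distinct residue classes modulo $\mathfrak{p}$ occupied by elements of $A$, and $\nu(\mathfrak{p})$ is a real number given for each $\mathfrak{p}\in P$. The symbol $\ll_K$ means that the inequality holds up to a multiplicative constant depending only on $K$.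
   Formalization: A is taken nonempty, and when r > 0 the bound is for H ≥ H0 with any fixed H0 > 1, the implied constant depending on K and H0 (C_K only on K); as printed it fails for A = {0} and H near 1, and for A empty with ν(p) < 1. *)

(* Defs.v *)
From HB Require Import structures.
From mathcomp Require Import all_boot all_order all_algebra all_field.
From mathcomp Require Import finmap.
From mathcomp Require Import all_classical all_reals all_analysis.
From mathcomp Require Import complex.
Set Implicit Arguments.
Unset Strict Implicit.
Unset Printing Implicit Defensive.
Import Order.TTheory GRing.Theory Num.Theory.
Import numFieldNormedType.Exports.
Local Open Scope classical_set_scope.
Local Open Scope ring_scope.

Definition integral_pred (K : fieldExtType rat) : {pred K} :=
  fun x => `[< integralOver (intr : int -> K) x >].
Arguments integral_pred : clear implicits.

Lemma integral_pred_subring (K : fieldExtType rat) :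
  subring_closed (integral_pred K).
Proof.
split=> [|x y /asboolP ix /asboolP iy|x y /asboolP ix /asboolP iy].
- exact/asboolP/integral1.
- exact/asboolP/integral_sub.
- exact/asboolP/integral_mul.
Qed.

HB.instance Definition _ (K : fieldExtType rat) :=
  GRing.isSubringClosed.Build K (integral_pred K) (@integral_pred_subring K).

Section RingOfIntegers.
Variable K : fieldExtType rat.

Record ring_of_integers := RingOfIntegers {
  int_val :> K ; int_valP : int_val \in integral_pred K }.

HB.instance Definition _ := [isSub for int_val].
HB.instance Definition _ := [Choice of ring_of_integers by <:].
HB.instance Definition _ :=
  [SubChoice_isSubComNzRing of ring_of_integers by <:].

End RingOfIntegers.

Section Ideals.
Variable K : fieldExtType rat.
Local Notation OK := (ring_of_integers K).

(* Nonzero prime ideals, i.e. those giving a place of K. The properness of the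
   ideal is part of [idealr_closed]. *)
Definition is_prime_ideal (p : set OK) : Prop :=
  [/\ idealr_closed (mem p), prime_idealr_closed (mem p) & p <> [set 0]].

Definition residue_class (p : set OK) (x : OK) : set OK := [set y | p (y - x)].

(* Number of residue classes modulo p occupied by A; [fset_set] of an infinite
   set is empty, but O_K / p is finite for a nonzero prime p. *)
Definition card_mod (A p : set OK) : nat :=
  #|` fset_set (residue_class p @` A)|.

Definition ideal_norm (p : set OK) : nat := card_mod setT p.

Definition ideal_mul (I J : set OK) : set OK :=
  [set x | exists n (u v : 'I_n -> OK),
     (forall i, I (u i) /\ J (v i)) /\ x = \sum_i u i * v i].

Definition ideal_prod (s : seq (set OK)) : set OK := foldr ideal_mul setT s.

(* The factorization of the fractional ideal alpha O_K is written without
   inverses as alpha O_K * (product of t) = product of s, where s and t list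
   prime ideals with multiplicity; m is the resulting exponent of p. *)
Definition is_exponent (p : set OK) (alpha : K) (m : int) : Prop :=
  exists s t : seq (set OK),
    [/\ forall q, q \in s -> is_prime_ideal q,
        forall q, q \in t -> is_prime_ideal q,
        [set alpha * int_val y | y in ideal_prod t] =
          @int_val K @` ideal_prod s
      & m = (count_mem p s)%:Z - (count_mem p t)%:Z].

Definition ideal_val (p : set OK) (alpha : K) : int :=
  xget 0 (is_exponent p alpha).

(* The rational prime below p. *)
Definition residue_char (p : set OK) : nat :=
  xget 0%N [set l : nat | prime l /\ p (l%:R)].

Definition ramification_index (p : set OK) : int :=
  ideal_val p (residue_char p)%:R.

(* Independent families in the group of units: the elements of K^* that are
   integral together with their inverse. *)
Definition indep_units (n : nat) (u : 'I_n -> K) : Prop :=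
  (forall i, [/\ u i != 0, u i \in integral_pred K
               & (u i)^-1 \in integral_pred K]) /\
  (forall m : 'I_n -> int, \prod_i u i ^ m i = 1 -> forall i, m i = 0).

Definition unit_rank : nat :=
  xget 0%N [set r | (exists u : 'I_r -> K, indep_units u) /\
    forall n (u : 'I_n -> K), indep_units u -> (n <= r)%N].

End Ideals.

Arguments unit_rank : clear implicits.

Section Height.
Variables (R : realType) (K : fieldExtType rat).

Definition arch_abs (sigma : {rmorphism K -> R[i]}) (alpha : K) : R :=
  ComplexField.Normc.normc (sigma alpha).

Definition padic_abs (p : set (ring_of_integers K)) (alpha : K) : R :=
  if alpha == 0 then 0
  else (residue_char p)%:R `^
         (- (ideal_val p alpha)%:~R / (ramification_index p)%:~R).

(* A place is represented by its normalized absolute value: conjugate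
   embeddings have the same one, other distinct embeddings and distinct prime
   ideals have different ones. *)
Definition places : set (K -> R) :=
  range arch_abs `|` padic_abs @` @is_prime_ideal K.

Section Completion.
Variable v : K -> R.

Definition v_cauchy (x : nat -> K) : Prop :=
  forall e : R, 0 < e -> exists N : nat,
    forall m n : nat, (N <= m)%N -> (N <= n)%N -> v (x m - x n) < e.

Definition v_null (x : nat -> K) : Prop := v (x n) @[n --> \oo] --> (0 : R).

Definition v_cauchy_rat (c : nat -> rat) : Prop := v_cauchy (fun n => (c n)%:A).

(* The completion K_v is the ring of v-Cauchy sequences of K modulo the
   v-null ones, and Q_v is its analogue for the restriction of v to rat. This
   says that b represents a basis of K_v over Q_v. *)
Definition completion_basis (d : nat) (b : 'I_d -> nat -> K) : Prop :=
  [/\ forall i, v_cauchy (b i),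
      forall x, v_cauchy x -> exists c : 'I_d -> nat -> rat,
        (forall i, v_cauchy_rat (c i)) /\
        v_null (fun n => x n - \sum_i c i n *: b i n)
    & forall c : 'I_d -> nat -> rat, (forall i, v_cauchy_rat (c i)) ->
        v_null (fun n => \sum_i c i n *: b i n) ->
        forall i, v_null (fun n => (c i n)%:A)].

Definition local_degree : nat :=
  xget 0%N [set d | exists b : 'I_d -> nat -> K, completion_basis b].

End Completion.

(* Only finitely many factors differ from 1, so this finitely supported product
   is the product over all places. *)
Definition height (alpha : K) : R :=
  \big[*%R/1]_(v \in places) Num.max 1 (v alpha ^+ local_degree v).

End Height.

(* Main.v *)
From HB Require Import structures.
Require Import Defs.
From mathcomp Require Import all_boot all_order all_algebra all_field.
From mathcomp Require Import finmap.
From mathcomp Require Import all_classical all_reals all_analysis.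
From mathcomp Require Import complex ring lra.
Set Implicit Arguments.
Unset Strict Implicit.
Unset Printing Implicit Defensive.
Import Order.TTheory GRing.Theory Num.Theory.
Local Open Scope classical_set_scope.
Local Open Scope ring_scope.

(* Two elements of O_K whose absolute values at every archimedean place are
   bounded by B_v differ by an element of norm O(prod B_v^n_v), so the product of
   the norms of the primes p in P at which they collide is bounded by that
   quantity: O_K / (x) has O(|N x|) elements, and the quotients by distinct primes
   containing x are independent. Gallagher's larger sieve then bounds the number
   of elements of A in such a box. Since the local heights at the archimedean
   places multiply to at most H, rounding the logarithms of all of them but one
   covers A by O((log H)^(s-1)) boxes with prod B_v^n_v = O(H), where s is the
   number of archimedean places. Finally s - 1 <= rank of the units, the hard half
   of Dirichlet's theorem, which comes from a pigeonhole form of Minkowski's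
   theorem. *)

(** The height is a product over completions and prime exponents, but only a lower bound for it at
    integral elements enters. At an archimedean place it comes from n_v being at least the number of
    embeddings inducing that place: one basis element of K_v cannot suffice when the image of K is
    not real. At a finite place it comes from integral elements having absolute value at most 1,
    that is, from the sign of whichever exponent [xget] selects; Nakayama's lemma gives that sign.
    Indices are measured without an integral basis: a fixed integer [den] multiplies O_K into Z[t],
    t a primitive integral element, at the cost of a factor |den|^d in every norm. The final
    constant is C_K = (2 e |den|)^d, with 2 from the triangle inequality at each embedding and e
    from rounding logarithms to integers. Independent units have to be bounded in number as well as
    constructed, because [unit_rank] is a maximum only if a maximum exists. Two pigeonhole arguments
    in logarithmic boxes and in lattice boxes therefore share one lemma. *)

Local Notation cabs := ComplexField.Normc.normc.
Local Notation Re := complex.Re.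
Local Notation Im := complex.Im.
Local Notation intK := (integralOver (intr : int -> _)).

(** * Integral elements *)

(** By Gauss's lemma the factor X - q of a monic integer polynomial is [a] times an integer factor
    [p1]. The leading coefficient of [p1] divides 1, so [a] is 1 or -1. *)
Lemma rat_integral_int (q : rat) :
  integralOver (intr : int -> rat) q -> exists n : int, q = n%:~R.
Proof.
case=> p monp; rewrite -dvdp_XsubCl => /dvdpP_rat_int[p1 [a a0 Ep1] [r Er]].
have lp1 : a * (lead_coef p1)%:~R = 1.
  have := congr1 lead_coef Ep1; rewrite lead_coefXsubC lead_coefZ => E1.
  by rewrite [RHS]E1 (lead_coef_map_inj (@intr_inj rat)).
have : lead_coef p1 \is a GRing.unit.
  have := monicP monp; rewrite Er lead_coefM => Eu.
  by apply/unitrP; exists (lead_coef r); split=> //; rewrite mulrC.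
have : - q = a * (p1`_0)%:~R.
  have := congr1 (coefp 0) Ep1; rewrite /coefp coefZ coef_map /= => <-.
  by rewrite coefB coefX coefC sub0r.
move=> Eq uu.
have {uu lp1} Ea : a = (lead_coef p1)%:~R.
  have [E|E] : lead_coef p1 = 1 \/ lead_coef p1 = -1.
  - by move: uu => /orP[]/eqP; [left|right].
  - by move: lp1; rewrite E mulr1.
  - by move: lp1; rewrite E mulrN1 => /(canRL opprK) ->.
exists (- (lead_coef p1 * p1`_0)).
by rewrite rmorphN rmorphM /= -Ea -Eq opprK.
Qed.

Lemma integral_ratr_int (F : numFieldType) (q : rat) :
  integralOver (intr : int -> F) (ratr q) -> exists n : int, q = n%:~R.
Proof.
case=> p monp rootp; apply: rat_integral_int; exists p => //.
rewrite -(fmorph_root (ratr : rat -> F)) -map_poly_comp.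
by rewrite (eq_map_poly (fun n => ratr_int F n)).
Qed.

Lemma intr_ext_inj (K : fieldExtType rat) : injective (intr : int -> K).
Proof.
move=> m n /eqP; rewrite -!(rmorph_int (in_alg K)) (inj_eq (fmorph_inj _)).
by move/eqP/intr_inj.
Qed.

Lemma intr_ext_eq0 (K : fieldExtType rat) (n : int) :
  (n%:~R == 0 :> K) = (n == 0).
Proof. by rewrite -(inj_eq (@intr_ext_inj K)). Qed.

Lemma integral_multiple (K : fieldExtType rat) (x : K) :
  exists2 c : int, c != 0 & integralOver (intr : int -> K) (c%:~R * x).
Proof.
have /polyOver1P[f Ef] := minPolyOver 1 x.
have [p [a a0 Ep]] := rat_poly_scale f.
have p0 : p != 0.
  apply: contra_neq (monic_neq0 (monic_minPoly 1 x)) => p0.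
  by rewrite Ef Ep p0 map_poly0 scaler0 map_poly0.
have rp : (map_poly (intr : int -> K) p).[x] = 0.
  have /rootP : root (minPoly 1 x) x by apply: root_minPoly.
  rewrite Ef Ep map_polyZ /= hornerZ -map_poly_comp => /eqP.
  rewrite mulf_eq0 scaler_eq0 oner_eq0 orbF invr_eq0 intr_eq0 (negbTE a0) /=.
  rewrite (@eq_map_poly _ _ _ (intr : int -> K)) => [/eqP//|n].
  exact: rmorph_int.
pose c := lead_coef p; pose n := (size p).-1.
exists c; first by rewrite lead_coef_eq0.
have sp : size p = n.+1 by rewrite prednK // size_poly_gt0.
have n0 : (0 < n)%N.
  rewrite lt0n; apply/eqP => n0; move: rp.
  have /size_poly1P[e e0 ->] : size p == 1%N by rewrite sp n0.
  rewrite map_polyC hornerC.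
  by move=> E; case/negP: e0; rewrite -(intr_ext_eq0 K); apply/eqP.
(* The monic polynomial with q(c x) = c^(n-1) p(x), obtained by distributing the powers of the
   leading coefficient [c] over the terms of [p]. *)
pose q : {poly int} :=
  \poly_(i < n.+1) (if i == n then 1 else p`_i * c ^+ (n.-1 - i)).
exists q.
  by rewrite monicE lead_coef_poly // eqxx.
apply/rootP; rewrite horner_coef.
have sq : size (map_poly (intr : int -> K) q) = n.+1.
  by rewrite size_map_inj_poly ?size_poly_eq ?eqxx //; exact: intr_ext_inj.
transitivity (c%:~R ^+ n.-1 * (map_poly (intr : int -> K) p).[x]); last first.
  by rewrite rp mulr0.
rewrite sq horner_coef size_map_inj_poly //; last exact: intr_ext_inj.
rewrite sp mulr_sumr; apply: eq_bigr => i _.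
rewrite !coef_map coef_poly ltn_ord /=.
case: eqP => [->|/eqP iN].
  rewrite mul1r exprMn mulrA; congr (_ * _).
  by rewrite -[in LHS](prednK n0) exprSr /c lead_coefE.
have iln : (i <= n.-1)%N by rewrite -ltnS prednK // ltn_neqAle iN -ltnS ltn_ord.
rewrite rmorphM rmorphXn /= exprMn [RHS]mulrCA -!mulrA; congr (_ * _).
by rewrite mulrA -exprD subnK.
Qed.

Lemma exists_integral_generator (K : fieldExtType rat) :
  exists t : K, integralOver (intr : int -> K) t /\ ({:K} = <<1; t>>)%VS.
Proof.
have sepK : separable 1 {:K}.
  by apply/separableP=> y _; apply: pcharf0_separable => p; rewrite pchar_lalg pchar_num.
have E := eq_adjoin_separable_generator sepK (sub1v _).
set g := separable_generator _ _ in E.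
have [c c0 ic] := integral_multiple g.
exists (c%:~R * g); split=> //; apply/eqP; rewrite eqEsubv subvf andbT.
rewrite [X in (X <= _)%VS]E; apply/FadjoinP; rewrite sub1v; split=> //.
have cK : c%:~R != 0 :> K by rewrite intr_ext_eq0.
suff: c%:~R^-1 * (c%:~R * g) \in (<<1; c%:~R * g>>)%VS by rewrite mulKf.
rewrite memvM ?memv_adjoin // memvV.
by apply: (subvP (sub1v _)); rewrite -(rmorph_int (in_alg K)) memvZ ?mem1v.
Qed.

(** * Embeddings of a number field *)

Section Embeddings.
Variables (K : fieldExtType rat) (C : numClosedFieldType).

Local Notation ev t p := ((map_poly (in_alg K) p).[t]).

(** Polynomials representing an element are chosen arbitrarily; [ker] makes the value at [z]
    independent of the choice, and additivity and multiplicativity follow from that independence. *)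
Lemma exists_embedding (t : K) (z : C) :
  (forall x : K, exists p, x = ev t p) ->
  (forall p, ev t p = 0 -> (map_poly ratr p).[z] = 0) ->
  exists s : {rmorphism K -> C}, forall p, s (ev t p) = (map_poly ratr p).[z].
Proof.
move=> gen ker.
pose cf x := sval (cid (gen x)).
have cfE x : x = ev t (cf x) by rewrite /cf; case: cid.
pose sig x : C := (map_poly ratr (cf x)).[z].
have sigE p : sig (ev t p) = (map_poly ratr p).[z].
  apply/eqP; rewrite -subr_eq0 -hornerN -hornerD -rmorphB ker //.
  by rewrite rmorphB hornerD hornerN -cfE subrr.
have sigB : zmod_morphism sig.
  move=> x y; rewrite [x in LHS]cfE [y in LHS]cfE -hornerN -hornerD -rmorphB sigE.
  by rewrite rmorphB hornerD hornerN.
have sigM : monoid_morphism sig.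
  split=> [|x y].
    have -> : 1 = ev t 1 by rewrite rmorph1 hornerC.
    by rewrite sigE rmorph1 hornerC.
  by rewrite [x in LHS]cfE [y in LHS]cfE -hornerM -rmorphM sigE rmorphM hornerM.
pose s : {rmorphism K -> C} := HB.pack sig
  (GRing.isZmodMorphism.Build _ _ sig sigB)
  (GRing.isMonoidMorphism.Build _ _ sig sigM).
by exists s.
Qed.

Lemma rmorph_ev (s : {rmorphism K -> C}) (t : K) p :
  s (ev t p) = (map_poly ratr p).[s t].
Proof.
rewrite -horner_map -map_poly_comp; congr (_.[_]); apply: eq_map_poly => q /=.
by rewrite -[RHS](fmorph_eq_rat [the {rmorphism rat -> C} of s \o in_alg K]).
Qed.

(** There is one embedding for each complex root of the minimal polynomial of a primitive integral
    element. The roots are distinct by separability, and reduction modulo this polynomial makes the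
    powers below [d] span K. *)
Theorem embeddings :
  exists (t : K) (d : nat) (s : 'I_d -> {rmorphism K -> C}),
  [/\ integralOver (intr : int -> K) t,
      injective (fun j => s j t),
      forall u : {rmorphism K -> C}, exists j, u =1 s j
    & forall x : K, exists c : 'rV[rat]_d, x = \sum_i c 0 i *: t ^+ i].
Proof.
have [t [it Et]] := exists_integral_generator K.
have gen x : exists p, x = ev t p by apply/Fadjoin1_polyP; rewrite -Et memvf.
have /polyOver1P[f Ef] := minPolyOver 1 t.
have monf : f \is monic by rewrite -(map_monic (in_alg K)) -Ef monic_minPoly.
have ft : ev t f = 0 by apply/rootP; rewrite -Ef root_minPoly.
have kerf p : ev t p = 0 -> f %| p.
  move=> /rootP rp; rewrite -(dvdp_map (in_alg K)) -Ef; apply: minPoly_dvdp => //.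
  by apply/polyOver1P; exists p.
have [r] := closed_field_poly_normal (map_poly (ratr : rat -> C) f).
rewrite lead_coef_map (monicP monf) rmorph1 scale1r => Er.
have ur : uniq r.
  rewrite -separable_prod_XsubC -Er separable_map -(separable_map (in_alg K)) -Ef.
  have : separable_element 1 t by apply: pcharf0_separable => p; rewrite pchar_lalg pchar_num.
  by [].
have kerr (j : 'I_(size r)) p : ev t p = 0 -> (map_poly ratr p).[r`_j] = 0.
  move=> /kerf/dvdpP[q ->]; rewrite rmorphM hornerM /= Er.
  have /rootP -> : root (\prod_(z <- r) ('X - z%:P)) r`_j.
    by rewrite root_prod_XsubC mem_nth.
  by rewrite mulr0.
pose s j := sval (cid (exists_embedding gen (kerr j))).
have sE j p : s j (ev t p) = (map_poly ratr p).[r`_j] by rewrite /s; case: cid.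
have st j : s j t = r`_j.
  by have := sE j 'X; rewrite !map_polyX !hornerX.
exists t, (size r), s; split=> //.
- move=> i j /=; rewrite !st => /eqP; rewrite nth_uniq // => /eqP; exact: val_inj.
- move=> u; have : u t \in r.
    by rewrite -root_prod_XsubC -Er; apply/rootP; rewrite -rmorph_ev ft rmorph0.
  move=> /(nthP 0)[i ir Ei]; exists (Ordinal ir) => x.
  by have [p ->] := gen x; rewrite rmorph_ev sE /= Ei.
- move=> x; have [p ->] := gen x.
  have -> : ev t p = ev t (p %% f).
    by rewrite {1}(divp_eq p f) rmorphD rmorphM hornerD hornerM ft mulr0 add0r.
  exists (\row_i (p %% f)`_i).
  have sf : size f = (size r).+1.
    by rewrite -(size_map_poly (ratr : {rmorphism rat -> C})) Er size_prod_XsubC.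
  have sm : (size (map_poly (in_alg K) (p %% f)) <= size r)%N.
    by rewrite size_map_poly -ltnS -sf ltn_modp monic_neq0.
  rewrite (horner_coef_wide _ sm); apply: eq_bigr => i _.
  by rewrite mxE coef_map /= mulr_algl.
Qed.

End Embeddings.

(** * Index of a sublattice *)

Section SmithIndex.
Variable d : nat.

(** With the Smith form W = L diag(e) Q, multiplication by Q^-1 carries the lattice spanned by the
    rows of [W] to the product of the e_i Z. Hence the residues of the coordinates of f(a) Q^-1
    modulo the e_i determine [a], and there are |det W| residue vectors. *)
Lemma index_le_det (W : 'M[int]_d) (T : finType) (f : T -> 'rV[int]_d) :
  \det W != 0 ->
  (forall a b w, f a - f b = w *m W -> a = b) ->
  (#|T| <= `|\det W|)%N.
Proof.
have [L uL [Q uQ [e _ EW]]] := int_Smith_normal_form W.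
have absu (M : 'M[int]_d) : M \in unitmx -> `|\det M|%N = 1%N.
  by rewrite unitmxE => /orP[]/eqP ->.
pose g a := f a *m invmx Q.
have detW : `|\det W|%N = (\prod_(i < d) absz (e`_i)%R)%N.
  rewrite EW !det_mulmx !abszM (absu L) // (absu Q) // mul1n muln1.
  rewrite (_ : \matrix_(i, j) _ = diag_mx (\row_i e`_i)); last first.
    by apply/matrixP=> i j; rewrite !mxE.
  rewrite det_diag (big_morph absz abszM absz1).
  by apply: eq_bigr => i _; rewrite mxE.
move=> W0 inj.
have e0 (i : 'I_d) : (0 < absz (e`_i)%R)%N.
  rewrite lt0n; apply: contra_neq W0 => ei0; apply/eqP; rewrite -absz_eq0 detW.
  by rewrite (bigD1 i) //= ei0 mul0n.
have e0' (i : 'I_d) : e`_i != 0 by rewrite -absz_gt0.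
have lt_mod (a : T) (i : 'I_d) : (absz (modz (g a 0%R i) (e`_i)%R) < absz (e`_i)%R)%N.
  by rewrite -ltz_nat gez0_abs ?modz_ge0 // abszE ltz_mod.
pose h (a : T) : {dffun forall i : 'I_d, 'I_(absz (e`_i)%R)} :=
  [ffun i => Ordinal (lt_mod a i)].
have hinj : injective h.
  move=> a b /ffunP hab.
  have dvd (i : 'I_d) : (e`_i %| (g a 0 i - g b 0 i)%R)%Z.
    rewrite -eqz_mod_dvd; apply/eqP.
    have := congr1 (fun z : 'I__ => (z : nat)%:Z) (hab i).
    by rewrite !ffunE /= !gez0_abs ?modz_ge0.
  pose k : 'rV[int]_d := \row_i divz (g a 0 i - g b 0 i) e`_i.
  apply: (inj a b (k *m invmx L)).
  rewrite [in RHS]EW !mulmxA mulmxKV //.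
  have -> : f a - f b = (g a - g b) *m Q by rewrite mulmxBl !mulmxKV.
  congr (_ *m _); rewrite {}/k; move: (g a) (g b) dvd => u v dvd.
  apply/rowP=> i; rewrite !mxE (bigD1 i) //= !mxE eqxx mulr1n.
  rewrite big1 ?addr0; last first.
    by move=> j ji; rewrite !mxE (inj_eq val_inj) (negbTE ji) mulr0n mulr0.
  by rewrite divzK.
rewrite detW -(card_codom hinj); apply: leq_trans (max_card _) _.
rewrite card_dep_ffun foldrE big_map big_enum.
by under eq_bigr do rewrite card_ord.
Qed.

End SmithIndex.

Lemma integral_emb (K : fieldExtType rat) (F : fieldType) (u : {rmorphism K -> F}) x :
  integralOver (intr : int -> K) x -> integralOver (intr : int -> F) (u x).
Proof.
move=> /(integral_rmorph u)[p monp rp]; exists p => //.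
by rewrite (eq_map_poly (g := u \o intr)) // => n /=; rewrite rmorph_int.
Qed.

Lemma integral_sumr (F : fieldType) (I : finType) (f : I -> F) :
  (forall i, integralOver (intr : int -> F) (f i)) ->
  integralOver (intr : int -> F) (\sum_i f i).
Proof.
move=> intf; apply: (big_ind (fun x => integralOver (intr : int -> F) x)) => //.
  exact: mxpoly.integral0.
by move=> x y; apply: integral_add.
Qed.

Lemma integral_prodr (F : fieldType) (I : finType) (f : I -> F) :
  (forall i, integralOver (intr : int -> F) (f i)) ->
  integralOver (intr : int -> F) (\prod_i f i).
Proof.
move=> intf; apply: (big_ind (fun x => integralOver (intr : int -> F) x)) => //.
  exact: integral1.
by move=> x y; apply: integral_mul.
Qed.

Section ComplexAbs.
Variable R : realType.
Implicit Types x y : R[i].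

Lemma cabsE x : `|x| = (cabs x)%:C%C.
Proof. by []. Qed.

Lemma cabs_ge0 x : 0 <= cabs x.
Proof. by case: x => a b; apply: sqrtr_ge0. Qed.

Lemma cabs_eq0 x : (cabs x == 0) = (x == 0).
Proof.
apply/eqP/eqP => [/ComplexField.Normc.eq0_normc//|->].
exact: ComplexField.Normc.normc0.
Qed.

Lemma cabs_gt0 x : (0 < cabs x) = (x != 0).
Proof. by rewrite lt_def cabs_ge0 andbT cabs_eq0. Qed.

Lemma cabsD x y : cabs (x + y) <= cabs x + cabs y.
Proof. by rewrite -lecR rmorphD -!cabsE ler_normD. Qed.

Lemma cabsN x : cabs (- x) = cabs x.
Proof. by apply: complexI; rewrite -!cabsE normrN. Qed.

Lemma cabs_int (n : int) : cabs n%:~R = `|n|%:~R :> R.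
Proof.
by apply: complexI; rewrite -cabsE -intr_norm rmorph_int.
Qed.

Lemma cabs_prod (I : finType) (F : I -> R[i]) :
  cabs (\prod_i F i) = \prod_i cabs (F i).
Proof.
apply: (big_morph _ (@ComplexField.Normc.normcM R)).
exact: ComplexField.Normc.normc1.
Qed.

End ComplexAbs.

(** * Coordinates, norm and trace *)

(** One fixed choice of a primitive integral element and of a list of the embeddings. [deg] is the
    degree of K: the powers of [gen] span by [coord_ex], and they are independent because the
    Vandermonde matrix of the conjugates of [gen] is invertible. *)
Record emb_system (R : realType) (K : fieldExtType rat) := EmbSystem {
  gen : K;
  deg : nat;
  emb : 'I_deg -> {rmorphism K -> R[i]};
  gen_int : integralOver (intr : int -> K) gen;
  emb_gen_inj : injective (fun j => emb j gen);
  emb_all : forall u : {rmorphism K -> R[i]}, exists j, u =1 emb j;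
  coord_ex : forall x : K, exists c : 'rV[rat]_deg, x = \sum_i c 0 i *: gen ^+ i
}.

Lemma emb_system_ex R K : inhabited (emb_system R K).
Proof.
by have [t [d [s [it sinj sall sc]]]] := embeddings K R[i]; do 2![econstructor]; eauto.
Qed.

Section EmbSystem.
Variables (R : realType) (K : fieldExtType rat) (S : emb_system R K).
Local Notation d := (deg S).
Local Notation t := (gen S).
Local Notation s := (@emb R K S).

Let V : 'M[R[i]]_d := Vandermonde d (\row_j s j t).

Lemma rmorph_ratZ (u : {rmorphism K -> R[i]}) (q : rat) x : u (q *: x) = ratr q * u x.
Proof.
rewrite -mulr_algl rmorphM; congr (_ * _).
by rewrite -[LHS]/([the {rmorphism rat -> R[i]} of u \o in_alg K] q) fmorph_eq_rat.
Qed.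

Lemma V_unit : V \in unitmx.
Proof.
rewrite unitmxE unitfE det_Vandermonde; apply/prodf_neq0 => i _.
apply/prodf_neq0 => j ij; rewrite !mxE subr_eq0; apply/eqP => /(emb_gen_inj (e := S)) ji.
by rewrite ji ltnn in ij.
Qed.

Definition coord (x : K) : 'rV[rat]_d := sval (cid (coord_ex S x)).

Lemma coordE x : x = \sum_i coord x 0 i *: t ^+ i.
Proof. by rewrite /coord; case: cid. Qed.

Lemma emb_coordE (c : 'rV[rat]_d) j :
  s j (\sum_i c 0 i *: t ^+ i) = (map_mx ratr c *m V) 0 j.
Proof.
rewrite mxE rmorph_sum; apply: eq_bigr => i _.
by rewrite rmorph_ratZ !mxE rmorphXn.
Qed.

Lemma coord_inj (c e : 'rV[rat]_d) :
  \sum_i c 0 i *: t ^+ i = \sum_i e 0 i *: t ^+ i -> c = e.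
Proof.
move=> E; apply: (map_mx_inj (f := (ratr : {rmorphism rat -> R[i]}))).
apply: (can_inj (mulmxK V_unit)); apply/rowP => j.
by rewrite -!emb_coordE E.
Qed.

Lemma deg_gt0 : (0 < d)%N.
Proof.
rewrite lt0n; apply/eqP => d0.
have := coordE 1; rewrite big1 => [/eqP|i]; first by rewrite oner_eq0.
by have := ltn_ord i; rewrite [X in (_ < X)%N]d0.
Qed.

Definition mulM (x : K) : 'M[rat]_d := \matrix_(i, k) coord (t ^+ i * x) 0 k.

(** The Vandermonde matrix diagonalizes multiplication by [x], with the conjugates of [x] as
    eigenvalues. This makes the norm and the trace of [x] rational. *)
Lemma mulM_V x : map_mx ratr (mulM x) *m V = V *m diag_mx (\row_j s j x).
Proof.
rewrite mul_mx_diag; apply/matrixP => i j; rewrite !mxE -rmorphXn -rmorphM.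
rewrite [X in s j X](coordE (_ * _)) emb_coordE !mxE.
by apply: eq_bigr => k _; rewrite !mxE.
Qed.

Lemma emb_prod_rat x : \prod_j s j x = ratr (\det (mulM x)).
Proof.
have := congr1 determinant (mulM_V x).
rewrite !det_mulmx det_diag det_map_mx mulrC => /mulfI -> //.
  by apply: eq_bigr => j _; rewrite mxE.
by rewrite -unitfE -unitmxE V_unit.
Qed.

Lemma emb_sum_rat x : \sum_j s j x = ratr (\tr (mulM x)).
Proof.
have E : map_mx ratr (mulM x) = V *m diag_mx (\row_j s j x) *m invmx V.
  by rewrite -mulM_V mulmxK ?V_unit.
have -> : ratr (\tr (mulM x)) = \tr (map_mx (ratr : rat -> R[i]) (mulM x)).
  by rewrite /mxtrace rmorph_sum; apply: eq_bigr => i _; rewrite [RHS]mxE.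
rewrite E mxtrace_mulC mulmxA mulVmx ?V_unit // mul1mx mxtrace_diag.
by apply: eq_bigr => j _; rewrite mxE.
Qed.

Lemma emb_prod_int x : intK x -> exists n : int, \prod_j s j x = n%:~R.
Proof.
move=> ix; have [|n] := @integral_ratr_int R[i] (\det (mulM x)).
  by rewrite -emb_prod_rat; apply: integral_prodr => j; apply: integral_emb.
by rewrite emb_prod_rat => ->; exists n; rewrite ratr_int.
Qed.

Lemma emb_sum_int x : intK x -> exists n : int, \sum_j s j x = n%:~R.
Proof.
move=> ix; have [|n] := @integral_ratr_int R[i] (\tr (mulM x)).
  by rewrite -emb_sum_rat; apply: integral_sumr => j; apply: integral_emb.
by rewrite emb_sum_rat => ->; exists n; rewrite ratr_int.
Qed.

Lemma norm_ge1 x : intK x -> x != 0 -> 1 <= \prod_j cabs (s j x).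
Proof.
move=> ix x0; have [n En] := emb_prod_int ix.
rewrite -cabs_prod En cabs_int -[1]/(1%:~R) ler_int -gtz0_ge1 normr_gt0.
rewrite -(intr_eq0 R[i]) -En; apply/prodf_neq0 => j _.
by rewrite fmorph_eq0.
Qed.

Lemma integral_expr (x : K) n : intK x -> intK (x ^+ n).
Proof.
by move=> ix; elim: n => [|n IH]; [exact: mxpoly.integral1|rewrite exprS; exact: integral_mul].
Qed.

(* The determinant of the trace form of the powers of [t] clears denominators. *)
Lemma exists_denominator : exists2 D : int, D != 0 &
  forall x : K, intK x -> exists c : 'rV[int]_d,
    D%:~R * x = \sum_i (c 0 i)%:~R * t ^+ i.
Proof.
have it n : intK (t ^+ n) by apply: integral_expr; apply: gen_int.
pose trint x (ix : intK x) := sval (cid (emb_sum_int ix)).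
have trintE x (ix : intK x) : (trint x ix)%:~R = \sum_j s j x.
  by rewrite /trint; case: cid.
pose T : 'M[int]_d := \matrix_(i, k) trint _ (it (i + k)%N).
have TE : map_mx intr T = V *m V^T.
  apply/matrixP => i k; rewrite !mxE trintE; apply: eq_bigr => j _.
  by rewrite !mxE rmorphXn exprD.
exists (\det T).
  have : \det (map_mx intr T : 'M[R[i]]_d) != 0.
    rewrite TE det_mulmx det_tr mulf_neq0 //; by rewrite -unitfE -unitmxE V_unit.
  by rewrite det_map_mx intr_eq0.
move=> x ix.
pose b : 'rV[int]_d := \row_k trint _ (integral_mul ix (it k)).
exists (b *m \adj T).
(* Pairing [x] with the powers of [t] under the trace gives integers; Cramer's rule then recovers
   det T times the coordinates. *)
have key : map_mx ratr (coord x) *m map_mx intr T = map_mx intr b :> 'rV[R[i]]_d.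
  rewrite TE mulmxA; apply/rowP => k; rewrite !mxE trintE; apply: eq_bigr => j _.
  by rewrite -emb_coordE -coordE !mxE rmorphM rmorphXn.
have {}key : (\det T)%:~R *: coord x = map_mx intr (b *m \adj T).
  apply: (map_mx_inj (f := (ratr : {rmorphism rat -> R[i]}))).
  rewrite -map_mx_comp (eq_map_mx _ (fun n => ratr_int _ n)) map_mxM -key.
  rewrite -mulmxA -map_mxM mul_mx_adj map_scalar_mx mul_mx_scalar.
  by rewrite map_mxZ /= ratr_int.
rewrite {1}(coordE x) mulr_sumr; apply: eq_bigr => i _.
rewrite -(rmorph_int (in_alg K)) mulr_algl scalerA.
have := congr1 (fun M : 'rV_d => M 0 i) key; rewrite !mxE => ->.
by rewrite scaler_int mulrzl.
Qed.

Definition den : int := s2val (cid2 exists_denominator).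

Lemma den_neq0 : den != 0.
Proof. exact: (s2valP (cid2 exists_denominator)). Qed.

Lemma denP (x : K) : intK x -> exists c : 'rV[int]_d,
  den%:~R * x = \sum_i (c 0 i)%:~R * t ^+ i.
Proof. exact: (s2valP' (cid2 exists_denominator)). Qed.

End EmbSystem.

(** * Ideals of the ring of integers *)

HB.instance Definition _ (K : fieldExtType rat) :=
  GRing.RMorphism.copy (@int_val K) (val : ring_of_integers K -> K).

Section Index.
Variables (R : realType) (K : fieldExtType rat) (S : emb_system R K).
Local Notation d := (deg S).
Local Notation t := (gen S).
Local Notation s := (@emb R K S).
Local Notation OK := (ring_of_integers K).
Local Notation D := (den S).

Lemma int_valK (x : OK) : intK (int_val x).
Proof. exact/asboolP/(int_valP x). Qed.

(** The absolute value of the norm of D x. *)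
Definition normI (x : K) : R := `|D|%:~R ^+ d * \prod_j cabs (s j x).

(** Multiplication by [D] puts O_K inside Z[t]. There the elements D t^i x span a lattice whose
    determinant is the norm of D x, and two [D * y a] congruent modulo this lattice come from
    elements congruent modulo [x]. *)
Lemma index_le (x : OK) (T : finType) (y : T -> OK) :
  x != 0 -> (forall a b z, y a - y b = x * z -> a = b) ->
  #|T|%:R <= normI (int_val x).
Proof.
move=> x0 sep.
have ix i : intK (t ^+ i * int_val x).
  by apply: integral_mul (int_valK x); apply/integral_expr/gen_int.
pose cW i := sval (cid (denP S (ix i))).
have cWE i : D%:~R * (t ^+ i * int_val x) = \sum_k (cW i 0 k)%:~R * t ^+ k.
  by rewrite /cW; case: cid.
pose W : 'M[int]_d := \matrix_(i, k) cW i 0 k.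
pose V : 'M[R[i]]_d := Vandermonde d (\row_j s j t).
have WV : map_mx intr W *m V = V *m diag_mx (\row_j (D%:~R * s j (int_val x))).
  rewrite mul_mx_diag; apply/matrixP => i j; rewrite !mxE.
  have := congr1 (s j) (cWE i); rewrite !rmorphM rmorphXn rmorph_int rmorph_sum mulrCA => ->.
  by apply: eq_bigr => k _; rewrite !mxE rmorphM rmorphXn rmorph_int.
have detW : (\det W)%:~R = \prod_j (D%:~R * s j (int_val x)).
  have := congr1 determinant WV.
  rewrite !det_mulmx det_diag det_map_mx mulrC => /mulfI -> //.
    by apply: eq_bigr => j _; rewrite mxE.
  by rewrite -unitfE -unitmxE V_unit.
have W0 : \det W != 0.
  rewrite -(intr_eq0 R[i]) detW; apply/prodf_neq0 => j _.
  by rewrite mulf_neq0 ?intr_eq0 ?den_neq0 // fmorph_eq0.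
pose cy a := sval (cid (denP S (int_valK (y a)))).
have cyE a : D%:~R * int_val (y a) = \sum_k (cy a 0 k)%:~R * t ^+ k.
  by rewrite /cy; case: cid.
have tP : t \in integral_pred K by apply/asboolP/gen_int.
pose tO : OK := RingOfIntegers tP.
have /(index_le_det W0) : forall a b w, cy a - cy b = w *m W -> a = b.
  move=> a b w E; apply: (sep a b (\sum_i (w 0 i)%:~R * tO ^+ i)).
  apply: val_inj; rewrite rmorphB rmorphM /=.
  have D0 : D%:~R != 0 :> K by rewrite intr_ext_eq0 den_neq0.
  apply: (mulfI D0); rewrite mulrBr !cyE -sumrB.
  transitivity (\sum_k ((cy a - cy b) 0 k)%:~R * t ^+ k).
    by apply: eq_bigr => k _; rewrite !mxE rmorphB mulrBl.
  rewrite E rmorph_sum mulrA mulr_sumr.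
  transitivity (\sum_k \sum_i (w 0 i)%:~R * ((cW i 0 k)%:~R * t ^+ k)).
    apply: eq_bigr => k _; rewrite !mxE rmorph_sum mulr_suml.
    by apply: eq_bigr => i _; rewrite mxE rmorphM mulrA.
  rewrite exchange_big; apply: eq_bigr => i _.
  rewrite -mulr_sumr -cWE rmorphM rmorphXn rmorph_int /=; ring.
rewrite -(ler_nat R) => /le_trans; apply.
have -> : (absz (\det W))%:R = cabs (\det W)%:~R :> R by rewrite cabs_int -abszE.
rewrite detW cabs_prod; under eq_bigr do rewrite ComplexField.Normc.normcM cabs_int.
by rewrite big_split prodr_const card_ord.
Qed.

(** Unlike [idealr_closed], this admits the unit ideal, which is the value of [ideal_prod] on the
    empty sequence. *)
Definition ideal_set (I : set OK) :=
  I 0 /\ forall a u v, I u -> I v -> I (a * u + v).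

Definition separates (T : Type) (I : set OK) (y : T -> OK) :=
  forall a b, I (y a - y b) -> a = b.

Lemma ideal_mulr I a u : ideal_set I -> I u -> I (a * u).
Proof. by move=> [I0 IM] Iu; rewrite -[_ * _]addr0; apply: IM. Qed.

Lemma ideal_add I u v : ideal_set I -> I u -> I v -> I (u + v).
Proof. by move=> [I0 IM] Iu Iv; rewrite -[u]mul1r; apply: IM. Qed.

Lemma ideal_opp I u : ideal_set I -> I u -> I (- u).
Proof. by move=> iI Iu; rewrite -mulN1r; apply: ideal_mulr. Qed.

Lemma ideal_sub I u v : ideal_set I -> I u -> I v -> I (u - v).
Proof. by move=> iI Iu Iv; apply: ideal_add => //; apply: ideal_opp. Qed.

Lemma ideal_index_le (I : set OK) (x : OK) (T : finType) (y : T -> OK) :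
  ideal_set I -> I x -> x != 0 -> separates I y -> #|T|%:R <= normI (int_val x).
Proof.
move=> iI Ix x0 sep; apply: (index_le (y := y) x0) => a b z E; apply: sep.
by rewrite E mulrC; apply: ideal_mulr.
Qed.

Section Primes.
Variable p : set OK.
Hypothesis pP : is_prime_ideal p.

Lemma prime_ideal : ideal_set p.
Proof.
case: pP => -[p0 p1 pM] _ _; split; first by move: p0; rewrite inE.
by move=> a u v pu pv; have := pM a u v; rewrite !inE; apply.
Qed.

Lemma prime_proper : ~ p 1.
Proof. by case: pP => -[p0 p1 pM] _ _; move: p1; rewrite notin_setE. Qed.

Lemma prime_mul a b : p (a * b) -> p a \/ p b.
Proof.
case: pP => _ pM _ pab; have := pM a b; rewrite !inE => /(_ pab).
by case/orP; rewrite inE; [left|right].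
Qed.

Lemma prime_exp a n : p (a ^+ n) -> p a.
Proof.
elim: n => [|n IH]; first by move/prime_proper.
by rewrite exprS => /prime_mul[].
Qed.

Lemma prime_nonzero : exists2 x, p x & x != 0.
Proof.
case: pP => _ _ pn0; apply: contrapT => H; apply: pn0; apply/seteqP; split=> x.
  by move=> px /=; apply/eqP; apply: contrapT => /negP x0; apply: H; exists x.
by move=> /= ->; case: prime_ideal.
Qed.

(** A nonzero prime has bounded index, so two powers among 1, a, ..., a^n are congruent modulo [p].
    Cancelling the smaller one, which primality allows, leaves a^(j-i) congruent to 1. *)
Lemma prime_maximal a : ~ p a -> exists l, p (a * l - 1).
Proof.
move=> pa; have [x px x0] := prime_nonzero.
pose n := `|Num.ceil (normI (int_val x))|%N.
apply: contrapT => H.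
suff : separates p (fun i : 'I_n.+1 => a ^+ i).
  move=> /(ideal_index_le prime_ideal px x0); rewrite card_ord leNgt => /negP; apply.
  rewrite -natr1 /n natr_absz ger0_norm ?ceil_ge0; last first.
    by rewrite (lt_le_trans (ltrN10 R)) // mulr_ge0 ?exprn_ge0 // prodr_ge0 // => j _; apply: cabs_ge0.
  by rewrite (le_lt_trans (ceil_ge _)) // ltrDl.
have key (i j : 'I_n.+1) : (i < j)%N -> ~ p (a ^+ i - a ^+ j).
  move=> ij pij; have : p (a ^+ i * (1 - a ^+ (j - i))).
    by rewrite mulrBr mulr1 -exprD subnKC // ltnW.
  case/prime_mul => [/prime_exp//|p1].
  apply: H; exists (a ^+ (j - i).-1).
  rewrite -exprS prednK ?subn_gt0 // -opprB; exact: ideal_opp prime_ideal p1.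
move=> i j pij; apply/val_inj; case: (ltngtP i j) => //.
  by move/key.
by move/key; case; rewrite -opprB; exact: ideal_opp prime_ideal pij.
Qed.

End Primes.
End Index.

(** * Products of ideals *)

Section IdealProducts.
Variable K : fieldExtType rat.
Local Notation OK := (ring_of_integers K).
Implicit Types (I J L p q : set OK) (x y : OK).

Lemma ideal_setT : ideal_set (setT : set OK). Proof. by []. Qed.

Lemma ideal_sum I n (F : 'I_n -> OK) :
  ideal_set I -> (forall i, I (F i)) -> I (\sum_i F i).
Proof.
move=> iI IF; apply: (big_ind I) => //; first by case: iI.
by move=> x y; apply: ideal_add.
Qed.

Lemma ideal_mul_sub I J L :
  ideal_set L -> (forall x y, I x -> J y -> L (x * y)) -> ideal_mul I J `<=` L.
Proof.
move=> iL sub _ [n [u [v [uv ->]]]]; apply: ideal_sum => // i.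
by have [] := uv i; apply: sub.
Qed.

Lemma ideal_mul_mem I J x y : I x -> J y -> ideal_mul I J (x * y).
Proof.
move=> Ix Jy; exists 1%N, (fun=> x), (fun=> y); split=> //.
by rewrite big_ord1.
Qed.

Lemma ideal_mul_ideal I J : ideal_set I -> ideal_set (ideal_mul I J).
Proof.
move=> iI; split.
  by exists 0%N, (fun=> 0), (fun=> 0); split=> [[]//|]; rewrite big_ord0.
move=> a _ _ [n [u [v [uv ->]]]] [m [u' [v' [uv' ->]]]].
exists (n + m)%N, (fun i => match fintype.split i with inl j => a * u j | inr j => u' j end),
  (fun i => match fintype.split i with inl j => v j | inr j => v' j end); split.
  move=> i; case: (fintype.split i) => j; last exact: uv'.
  by have [Iu Jv] := uv j; split=> //; apply: ideal_mulr.
rewrite big_split_ord mulr_sumr /=; congr (_ + _); apply: eq_bigr => i _.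
  by rewrite -[lshift m i]/(unsplit (inl i)) unsplitK mulrA.
by rewrite -[rshift n i]/(unsplit (inr i)) unsplitK.
Qed.

Lemma ideal_prod_ideal (s : seq (set OK)) :
  (forall q, q \in s -> is_prime_ideal q) -> ideal_set (ideal_prod s).
Proof.
case: s => [_|q s qs]; first exact: ideal_setT.
by apply: ideal_mul_ideal; apply: prime_ideal; apply: qs; rewrite mem_head.
Qed.

End IdealProducts.

(** * Independence of distinct primes *)

Section PrimeIdeals.
Variables (R : realType) (K : fieldExtType rat) (S : emb_system R K).
Local Notation OK := (ring_of_integers K).
Local Notation normI := (@normI R K S).
Implicit Types (I J L p q : set OK) (x y : OK).

Lemma ideal_norm_separates p : ideal_set p ->
  exists (T : finType) (y : T -> OK), #|T| = ideal_norm p /\ separates p y.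
Proof.
move=> ip; pose X := fset_set (residue_class p @` setT).
have inX c : c \in X -> exists x, residue_class p x = c.
  rewrite /X; case: (pselect (finite_set (residue_class p @` setT))) => [fin|nfin].
    by rewrite in_fset_set // inE => -[x _ <-]; exists x.
  (* On an infinite set of classes [fset_set] is empty, and there is nothing to represent. *)
  by rewrite /fset_set; case: pselect => // _; rewrite inE.
pose y (i : X) := sval (cid (inX _ (valP i))).
have yE i : residue_class p (y i) = val i by rewrite /y; case: cid.
exists X, y; split; first by rewrite /ideal_norm /card_mod cardfE.
move=> i j pij; apply: val_inj; rewrite -!yE /residue_class; apply/seteqP; split=> z /= pz.
  by rewrite -(subrK (y i) z) -addrA; apply: ideal_add.
rewrite -(subrK (y j) z) -addrA; apply: ideal_add => //.
by rewrite -opprB; apply: ideal_opp.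
Qed.

Lemma prime_avoid p q : is_prime_ideal p -> is_prime_ideal q -> q <> p ->
  exists2 e, q e & ~ p e.
Proof.
move=> pP qP qp; apply: contrapT => H.
have sub : q `<=` p by move=> e qe; apply: contrapT => pe; apply: H; exists e.
apply: qp; apply/seteqP; split=> // a pa; apply: contrapT => qa.
have [l /sub pl] := prime_maximal S qP qa.
apply: (prime_proper pP); rewrite -(subKr (a * l) 1); apply: ideal_sub => //.
  exact: prime_ideal.
by rewrite mulrC; apply: ideal_mulr => //; apply: prime_ideal.
Qed.

Lemma primes_avoid p (P : seq (set OK)) : is_prime_ideal p ->
  (forall q, q \in P -> is_prime_ideal q) -> p \notin P ->
  exists2 e, (forall q, q \in P -> q e) & ~ p e.
Proof.
move=> pP; elim: P => [_ _|q P IH PP pqP].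
  by exists 1 => //; exact: prime_proper.
move: pqP; rewrite inE negb_or => /andP[pq pnP].
have [|e Pe pe] := IH _ pnP; first by move=> r rP; apply: PP; rewrite inE rP orbT.
have qP : is_prime_ideal q by apply: PP; rewrite mem_head.
have [f qf pf] := prime_avoid pP qP (fun E => negP pq (introT eqP (esym E))).
exists (e * f).
  move=> r; rewrite inE => /orP[/eqP ->|rP].
    by apply: ideal_mulr => //; apply: prime_ideal.
  by rewrite mulrC; apply: ideal_mulr (Pe _ rP); apply/prime_ideal/PP; rewrite inE rP orbT.
by case/(prime_mul pP).
Qed.

(** The Chinese remainder theorem, one prime at a time: [e] lies in every prime of the tail and is 1
    modulo the new [p], so e y2 + (1 - e) y1 reduces to y2 modulo [p] and to y1 modulo the
    others. *)
Lemma prod_norm_separates (P : seq (set OK)) : uniq P ->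
  (forall p, p \in P -> is_prime_ideal p) ->
  exists (T : finType) (y : T -> OK), #|T| = (\prod_(p <- P) ideal_norm p)%N /\
    separates [set x | forall p, p \in P -> p x] y.
Proof.
elim: P => [_ _|p P IH /= /andP[pnP uP] PP].
  exists 'I_1, (fun=> 0); rewrite card_ord big_nil; split=> //.
  by move=> i j _; rewrite !ord1.
have PP' q : q \in P -> is_prime_ideal q by move=> qP; apply: PP; rewrite inE qP orbT.
have [T1 [y1 [c1 sep1]]] := IH uP PP'.
have pP : is_prime_ideal p by apply: PP; rewrite mem_head.
have [T2 [y2 [c2 sep2]]] := ideal_norm_separates (prime_ideal pP).
have [e' Ie' pe'] := primes_avoid pP PP' pnP.
have [l pl] := prime_maximal S pP pe'.
pose e := e' * l; rewrite -/e in pl.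
have ip := prime_ideal pP.
have Ie q : q \in P -> q e.
  by move=> qP; rewrite /e mulrC; apply: ideal_mulr (Ie' _ qP); apply/prime_ideal/PP'.
exists (T1 * T2)%type, (fun ab => e * y2 ab.2 + (1 - e) * y1 ab.1); split.
  by rewrite card_prod c1 c2 big_cons mulnC.
move=> [a b] [a' b'] /= H.
have E : e * y2 b + (1 - e) * y1 a - (e * y2 b' + (1 - e) * y1 a')
  = e * (y2 b - y2 b') + (1 - e) * (y1 a - y1 a') by ring.
rewrite E in H; congr (_, _).
  apply: sep1 => q qP; have iq := prime_ideal (PP' _ qP).
  have -> : y1 a - y1 a' = (e * (y2 b - y2 b') + (1 - e) * (y1 a - y1 a'))
    + (y1 a - y1 a' - (y2 b - y2 b')) * e by ring.
  apply: ideal_add => //; first by apply: H; rewrite inE qP orbT.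
  by apply: ideal_mulr => //; apply: Ie.
apply: sep2.
have -> : y2 b - y2 b' = (e * (y2 b - y2 b') + (1 - e) * (y1 a - y1 a'))
    + (y1 a - y1 a' - (y2 b - y2 b')) * (e - 1) by ring.
apply: ideal_add => //; first by apply: H; rewrite mem_head.
exact: ideal_mulr.
Qed.

Lemma prod_norm_le (P : seq (set OK)) (x : OK) : uniq P ->
  (forall p, p \in P -> is_prime_ideal p) -> x != 0 ->
  (forall p, p \in P -> p x) ->
  (\prod_(p <- P) ideal_norm p)%:R <= normI (int_val x).
Proof.
move=> uP PP x0 Px; have [T [y [<- sep]]] := prod_norm_separates uP PP.
apply: (ideal_index_le S _ Px x0 sep); split=> [p pP|a u v Iu Iv p pP].
  by case: (prime_ideal (PP _ pP)).
by case: (prime_ideal (PP _ pP)) => _; apply; [apply: Iu|apply: Iv].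
Qed.

End PrimeIdeals.

(** * Exponents of primes in ideal products *)

Section Valuation.
Variables (R : realType) (K : fieldExtType rat) (S : emb_system R K).
Local Notation OK := (ring_of_integers K).
Implicit Types (I J L p q : set OK) (x y : OK).

Lemma ideal_det_congr I n (A B : 'M[OK]_n) : ideal_set I ->
  (forall i j, I (A i j - B i j)) -> I (\det A - \det B).
Proof.
move=> iI AB; rewrite /determinant -sumrB; apply: (big_ind I); first by case: iI.
  by move=> x y; apply: ideal_add.
move=> s _; rewrite -mulrBr; apply: ideal_mulr => //.
apply: (big_ind2 (fun x y => I (x - y))) => //; first by rewrite subrr; case: iI.
move=> x1 x2 y1 y2 Ix Iy.
have -> : x1 * y1 - x2 * y2 = y1 * (x1 - x2) + x2 * (y1 - y2) by ring.
by apply: ideal_add => //; apply: ideal_mulr.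
Qed.

(* An ideal is finitely generated because it has finite index over any of its
   nonzero principal subideals: take a maximal incongruent family. *)
Lemma ideal_finitely_generated I a : ideal_set I -> I a -> a != 0 ->
  exists (n : nat) (m : 'I_n -> OK),
    [/\ forall i, I (m i), exists i, m i != 0
      & forall x, I x -> exists c : 'I_n -> OK, x = \sum_i c i * m i].
Proof.
move=> iI Ia a0.
pose Q n := `[< exists y : 'I_n -> OK, (forall i, I (y i)) /\
  forall i j z, y i - y j = a * z -> i = j >].
have Q0 : exists n, Q n.
  by exists 0%N; apply/asboolP; exists (fun=> 0); split=> -[].
pose N := `|Num.ceil (normI S (int_val a))|%N.
have QN n : Q n -> (n <= N)%N.
  move=> /asboolP[y [_ sep]]; have := index_le S a0 sep; rewrite card_ord => le_n.
  rewrite -(ler_nat R) /N natr_absz ger0_norm.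
    by rewrite (le_trans le_n) // ceil_ge.
  by rewrite ceil_ge0 (lt_le_trans (ltrN10 R)) // (le_trans _ le_n).
have /asboolP := ex_maxnP Q0 QN; case: ex_maxnP => n /asboolP[y [Iy sep]] nmax _.
exists n.+1, (fun i => if unlift ord0 i is Some j then y j else a); split.
- by move=> i; case: unliftP.
- by exists ord0; rewrite unlift_none.
move=> x Ix.
have [j [z E]] : exists j z, x - y j = a * z.
  apply: contrapT => H.
  suff /nmax : Q n.+1 by rewrite ltnn.
  apply/asboolP; exists (fun i => if unlift ord0 i is Some j then y j else x).
  split=> [i|i j z]; first by case: unliftP.
  case: unliftP => [i' ->|->]; case: unliftP => [j' ->|->] //.
  - by move/sep ->.
  - move=> E; case: H; exists i', (- z); by rewrite mulrN -E opprB.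
  - by move=> E; case: H; exists j', z.
exists (fun i => if unlift ord0 i is Some i' then (i' == j)%:R else z).
rewrite big_ord_recl unlift_none (bigD1 j) //= liftK eqxx mul1r big1 ?addr0.
  by rewrite mulrC -E subrK.
by move=> i ij; rewrite liftK (negbTE ij) mul0r.
Qed.

Section PrimePower.
Variable p : set OK.
Hypothesis pP : is_prime_ideal p.

(* Nakayama's lemma by the determinant trick. *)
Lemma prime_mul_proper I a : ideal_set I -> I a -> a != 0 -> ~ I `<=` ideal_mul p I.
Proof.
move=> iI Ia a0 sub; have ip := prime_ideal pP.
have [n [m [Im [i0 mi0] gen]]] := ideal_finitely_generated iI Ia a0.
pose L := [set x : OK | exists2 w : 'I_n -> OK, (forall i, p (w i)) & x = \sum_i w i * m i].
have iL : ideal_set L.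
  split; first by exists (fun=> 0) => [i|]; [case: ip|rewrite big1 // => i _; rewrite mul0r].
  move=> b _ _ [u pu ->] [v pv ->]; exists (fun i => b * u i + v i).
    by move=> i; case: ip => _; apply.
  by rewrite mulr_sumr -big_split; apply: eq_bigr => i _ /=; ring.
have subL : ideal_mul p I `<=` L.
  apply: ideal_mul_sub => // x y px /gen[c ->]; exists (fun i => x * c i).
    by move=> i; rewrite mulrC; apply: ideal_mulr.
  by rewrite mulr_sumr; apply: eq_bigr => i _; rewrite mulrA.
pose w i := s2val (cid2 (subL _ (sub _ (Im i)))).
have pw i : forall j, p (w i j) by apply: (s2valP (cid2 (subL _ (sub _ (Im i))))).
have mE i : m i = \sum_j w i j * m j by apply: (s2valP' (cid2 (subL _ (sub _ (Im i))))).
pose A : 'M[OK]_n := 1%:M - \matrix_(i, j) w i j.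
have detA : \det A = 0.
  apply: val_inj; rewrite /= -det_map_mx; apply/eqP; apply: contraT => det0.
  have uA : map_mx (@int_val K) A \in unitmx by rewrite unitmxE unitfE.
  have /(congr1 (mulmx (invmx (map_mx (@int_val K) A)))) :
      map_mx (@int_val K) A *m (\col_i int_val (m i)) = 0.
    apply/colP => i; rewrite !mxE.
    under eq_bigr do rewrite !mxE rmorphB rmorph_nat mulrBl.
    rewrite sumrB (bigD1 i) //= eqxx mul1r big1 ?addr0; last first.
      by move=> j ji; rewrite eq_sym (negbTE ji) mul0r.
    rewrite {1}(mE i) rmorph_sum -sumrB big1 // => j _.
    by rewrite rmorphM subrr.
  rewrite mulKmx // mulmx0 => /colP/(_ i0); rewrite !mxE => E.
  by case/negP: mi0; apply/eqP/val_inj; rewrite /= E.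
have := @ideal_det_congr p n A 1%:M ip.
rewrite detA det1 => H; apply: (prime_proper pP).
rewrite -[1]opprK -[- 1]add0r; apply: ideal_opp => //; apply: H => i j.
by rewrite !mxE addrAC subrr add0r; apply: ideal_opp.
Qed.

Local Notation pow k := (ideal_prod (nseq k p)).

Lemma prime_pow_ideal k : ideal_set (pow k).
Proof. by apply: ideal_prod_ideal => q /nseqP[->]. Qed.

Lemma prime_pow_le k l : (k <= l)%N -> pow l `<=` pow k.
Proof.
elim: l k => [|l IH] k; first by rewrite leqn0 => /eqP ->.
rewrite leq_eqVlt => /orP[/eqP -> //|kl] x /= H; apply: (IH k) => //.
move: x H; apply: ideal_mul_sub; first exact: prime_pow_ideal.
by move=> x y px; apply: ideal_mulr; exact: prime_pow_ideal.
Qed.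

Lemma ideal_prod_sub_pow (s : seq (set OK)) :
  (forall q, q \in s -> is_prime_ideal q) ->
  ideal_prod s `<=` pow (count_mem p s).
Proof.
elim: s => // q s IH qs.
have {}IH : ideal_prod s `<=` pow (count_mem p s).
  by apply: IH => r rs; apply: qs; rewrite inE rs orbT.
have [->|qp] := eqVneq q p.
  rewrite /= eqxx add1n /=; apply: ideal_mul_sub.
    by apply: ideal_mul_ideal; apply: prime_ideal.
  by move=> x y px /IH py; apply: ideal_mul_mem.
rewrite /= (negbTE qp) add0n; apply: ideal_mul_sub; first exact: prime_pow_ideal.
by move=> x y _ /IH py; apply: ideal_mulr => //; exact: prime_pow_ideal.
Qed.

(** [j] is a product of elements outside [p], one from each factor of [s] other than [p]. It
    replaces localization at [p], where those factors become trivial. *)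
Lemma pow_mul_sub_ideal_prod (s : seq (set OK)) :
  (forall q, q \in s -> is_prime_ideal q) ->
  exists2 j, ~ p j & forall x, pow (count_mem p s) x -> ideal_prod s (j * x).
Proof.
elim: s => [_|q s IH qs]; first by exists 1 => //; apply: prime_proper.
have qs' r : r \in s -> is_prime_ideal r by move=> rs; apply: qs; rewrite inE rs orbT.
have [j pj Hj] := IH qs'.
have qP : is_prime_ideal q by apply: qs; rewrite mem_head.
have [E|/eqP qp] := eqVneq q p.
  exists j => //; rewrite /= E eqxx add1n /=; apply: (@ideal_mul_sub _ _ _ [set x | _]).
    have iM := ideal_mul_ideal (ideal_prod s) (prime_ideal pP).
    split=> /= [|a u v Iu Iv]; first by rewrite mulr0; case: iM.
    by rewrite mulrDr mulrCA; case: iM => _; apply.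
  by move=> x y px py /=; rewrite mulrCA; apply: ideal_mul_mem => //; apply: Hj.
have [e qe pe] := prime_avoid S pP qP qp.
exists (e * j); first by case/(prime_mul pP).
move=> x; rewrite /= (introF eqP qp) add0n => px; rewrite -mulrA.
by apply: ideal_mul_mem => //; apply: Hj.
Qed.

Lemma prime_pow_nonzero k : exists2 x, pow k x & x != 0.
Proof.
elim: k => [|k [x px x0]]; first by exists 1 => //; apply: oner_neq0.
have [y py y0] := prime_nonzero pP.
exists (y * x); first exact: ideal_mul_mem.
apply/eqP => /(congr1 (@int_val K)) /eqP; rewrite rmorphM rmorph0 mulf_eq0.
by rewrite -!(rmorph0 (@int_val K)) !(inj_eq val_inj) (negbTE x0) (negbTE y0).
Qed.

(* Otherwise some [j] outside [p] maps p^k into p^(k+1), and then so does 1, as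
   [j] is invertible modulo [p]: this contradicts Nakayama's lemma. *)
Lemma count_le_of_prod_sub (s u : seq (set OK)) :
  (forall q, q \in s -> is_prime_ideal q) ->
  (forall q, q \in u -> is_prime_ideal q) ->
  ideal_prod s `<=` ideal_prod u -> (count_mem p u <= count_mem p s)%N.
Proof.
move=> sP uP sub; rewrite leqNgt; apply/negP => lt_su.
have [j pj Hj] := pow_mul_sub_ideal_prod sP.
have [l pl] := prime_maximal S pP pj.
have [a pa a0] := prime_pow_nonzero (count_mem p s).
apply: (prime_mul_proper (prime_pow_ideal _) pa a0) => x px.
have iM : ideal_set (pow (count_mem p s).+1) by exact: prime_pow_ideal.
have jx : pow (count_mem p s).+1 (j * x).
  by apply/(prime_pow_le lt_su)/(ideal_prod_sub_pow uP)/sub/Hj.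
have -> : x = l * (j * x) - (j * l - 1) * x by ring.
by apply: ideal_sub => //; [apply: ideal_mulr|apply: ideal_mul_mem].
Qed.

(** Whichever factorization [xget] picks, integrality of [x] puts the numerator product inside the
    denominator product, which orders the multiplicities of [p]. The default value 0 has the right
    sign too. *)
Lemma ideal_val_ge0 (x : OK) : x != 0 -> 0 <= ideal_val p (int_val x).
Proof.
move=> x0; rewrite /ideal_val.
case: xgetP => // m _ [s [u [sP uP E ->]]].
rewrite subr_ge0 lez_nat; apply: count_le_of_prod_sub => // y sy.
have : [set int_val x * int_val y0 | y0 in ideal_prod u] (int_val y) by rewrite E; exists y.
move=> [z uz]; rewrite -rmorphM => /val_inj <-.
by apply: ideal_mulr => //; exact: ideal_prod_ideal.
Qed.

Lemma padic_abs_le1 (x : OK) : padic_abs R p (int_val x) <= 1.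
Proof.
rewrite /padic_abs; case: eqP => [_|/eqP x0]; first exact: ler01.
have x0' : x != 0 by apply: contra_neq x0 => ->; rewrite rmorph0.
set l := residue_char p.
(* If [residue_char] takes its default value 0, the power is 0 or 1. *)
have [l0|l0] := posnP l.
  by rewrite /powR l0 eqxx; case: (_ == 0); rewrite ?ler01 ?lexx.
have el : 0 <= ramification_index p.
  rewrite /ramification_index -(rmorph_nat (@int_val K)); apply: ideal_val_ge0.
  apply/eqP => /(congr1 (@int_val K))/eqP; rewrite rmorph_nat rmorph0 -/l.
  by rewrite (intr_ext_eq0 K l%:Z) eqz_nat eqn0Ngt l0.
rewrite mulNr powRN invf_le1 ?powR_gt0 ?ltr0n //.
rewrite -[leLHS](powRr0 l%:R) ler_powR ?ler1n //.
by rewrite divr_ge0 ?ler0z ?ideal_val_ge0.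
Qed.

End PrimePower.
End Valuation.

(** * Completions at archimedean places *)

Section ComplexParts.
Variable R : realType.
Implicit Types (x y z : R[i]).

Lemma cabs_sqr z : cabs z ^+ 2 = Re z ^+ 2 + Im z ^+ 2.
Proof. by case: z => a b; rewrite /= sqr_sqrtr // addr_ge0 ?sqr_ge0. Qed.

Lemma normr_Re_le z : `|Re z| <= cabs z.
Proof.
rewrite -(ler_pXn2r (ltn0Sn 1)) ?nnegrE ?cabs_ge0 // cabs_sqr real_normK ?num_real //.
by rewrite lerDl sqr_ge0.
Qed.

Lemma normr_Im_le z : `|Im z| <= cabs z.
Proof.
rewrite -(ler_pXn2r (ltn0Sn 1)) ?nnegrE ?cabs_ge0 // cabs_sqr real_normK ?num_real //.
by rewrite lerDr sqr_ge0.
Qed.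

Lemma cabs_le_ReIm z : cabs z <= `|Re z| + `|Im z|.
Proof.
rewrite -(ler_pXn2r (ltn0Sn 1)) ?nnegrE ?cabs_ge0 ?addr_ge0 // cabs_sqr.
by rewrite sqrrD !real_normK ?num_real // lerD2r lerDl mulrn_wge0 ?mulr_ge0.
Qed.

Lemma ratrC (q : rat) : ratr q = (ratr q : R)%:C%C :> R[i].
Proof. by rewrite fmorph_rat. Qed.

Lemma Re_ratM (q : rat) z : Re (ratr q * z) = ratr q * Re z.
Proof. by rewrite ratrC; case: z => a b /=; rewrite mul0r subr0. Qed.

Lemma Im_ratM (q : rat) z : Im (ratr q * z) = ratr q * Im z.
Proof. by rewrite ratrC; case: z => a b /=; rewrite mul0r addr0. Qed.

Lemma ReD x y : Re (x + y) = Re x + Re y. Proof. by case: x y => a b []. Qed.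
Lemma ImD x y : Im (x + y) = Im x + Im y. Proof. by case: x y => a b []. Qed.
Lemma ReN x : Re (- x) = - Re x. Proof. by case: x. Qed.
Lemma ImN x : Im (- x) = - Im x. Proof. by case: x. Qed.

Lemma cabs_rat (q : rat) : cabs (ratr q) = `|ratr q| :> R.
Proof. by rewrite ratrC /= expr0n addr0 sqrtr_sqr. Qed.

Lemma ratr_approx (r : R) (n : nat) : exists c : rat, `|r - ratr c| < n.+1%:R^-1.
Proof.
have n0 : 0 < n.+1%:R^-1 :> R by rewrite invr_gt0 ltr0n.
move: n0; move: (n.+1%:R^-1) => k k0.
have [|c] := @rat_in_itvoo R (r - k) (r + k); first lra.
rewrite in_itv /= => /andP[h1 h2]; exists c; rewrite ltr_norml.
by apply/andP; split; lra.
Qed.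

Lemma invn_eventually (e : R) : 0 < e -> exists N, forall n, (N <= n)%N -> n.+1%:R^-1 < e.
Proof.
move=> e0; exists (Num.truncn e^-1) => n Nn.
rewrite invf_plt ?posrE ?ltr0n //.
by rewrite (lt_le_trans (truncnS_gt _)) // ler_nat ltnS.
Qed.

End ComplexParts.

Section LocalDegree.
Variables (R : realType) (K : fieldExtType rat) (u : {rmorphism K -> R[i]}).
Local Notation v := (arch_abs u).

Lemma v_nullP (x : nat -> K) :
  v_null v x <-> (forall e, 0 < e -> exists N, forall n, (N <= n)%N -> v (x n) < e).
Proof.
split=> [/cvgr0Pnorm_lt H e e0|H].
  have [N _ HN] := H _ e0; exists N => n /HN /=.
  by rewrite ger0_norm // cabs_ge0.
apply/cvgr0Pnorm_lt => e e0; have [N HN] := H _ e0.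
by exists N => // n /= /HN; rewrite ger0_norm // cabs_ge0.
Qed.

Lemma arch_ratZ q x : u (q *: x) = ratr q * u x.
Proof. exact: rmorph_ratZ. Qed.

Lemma arch_rat q : v q%:A = `|ratr q|.
Proof. by rewrite /arch_abs arch_ratZ rmorph1 mulr1 cabs_rat. Qed.

Lemma v_cauchy_ratP (c : nat -> rat) : v_cauchy_rat v c <->
  forall e : R, 0 < e -> exists N, forall m n, (N <= m)%N -> (N <= n)%N ->
    `|ratr (c m) - ratr (c n) : R| < e.
Proof.
have E m n : v ((c m)%:A - (c n)%:A) = `|ratr (c m) - ratr (c n)|.
  by rewrite -scalerBl arch_rat rmorphB.
by split=> H e /H[N HN]; exists N => m n Nm Nn; have := HN m n Nm Nn; rewrite E.
Qed.

(** Elements of Q_v are represented by rational sequences, while coordinates read off in C are real: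
    the n-th term is rounded to within 1/(n+1). *)
Lemma cauchy_approx (r : nat -> R) :
  (forall e : R, 0 < e -> exists N, forall m n, (N <= m)%N -> (N <= n)%N ->
    `|r m - r n| < e) ->
  exists c : nat -> rat, v_cauchy_rat v c /\ forall n, `|r n - ratr (c n)| < n.+1%:R^-1.
Proof.
move=> Hr; pose c n := sval (cid (ratr_approx (r n) n)).
have cE n : `|r n - ratr (c n)| < n.+1%:R^-1 by rewrite /c; case: cid.
exists c; split=> //; apply/v_cauchy_ratP => e e0.
have e3 : 0 < e / 3 by rewrite divr_gt0.
have [N1 H1] := Hr _ e3; have [N2 H2] := invn_eventually e3.
exists (maxn N1 N2) => m n; rewrite !geq_max => /andP[m1 m2] /andP[n1 n2].
have := H1 _ _ m1 n1; have := H2 _ m2; have := H2 _ n2; have := cE m; have := cE n.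
move=> h1 h2 h3 h4 h5; have {h1 h3} h1 := lt_trans h1 h3; have {h2 h4} h2 := lt_trans h2 h4.
have -> : ratr (c m) - ratr (c n) = (r n - ratr (c n)) + (- (r m - ratr (c m))) + (r m - r n).
  by ring.
rewrite (le_lt_trans (ler_normD _ _)) // (le_lt_trans (lerD (ler_normD _ _) (lexx _))) //.
rewrite normrN; lra.
Qed.

Lemma real_completion_basis : (forall x, Im (u x) = 0) ->
  completion_basis v (fun (i : 'I_1) (n : nat) => 1).
Proof.
move=> real_u.
have vE x : v x = `|Re (u x)|.
  rewrite /arch_abs; case: (u x) (real_u x) => a b /= ->.
  by rewrite expr0n addr0 sqrtr_sqr.
split=> [i e e0|x xC|c cC cN i].
- by exists 0%N => m n _ _; rewrite subrr /arch_abs rmorph0 ComplexField.Normc.normc0.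
- have [|c [cC cx]] := cauchy_approx (r := fun n => Re (u (x n))).
    move=> e /xC[N HN]; exists N => m n Nm Nn; have := HN m n Nm Nn.
    by rewrite vE rmorphB ReD ReN.
  exists (fun=> c); split=> //; apply/v_nullP => e /(@invn_eventually R)[N HN].
  exists N => n /HN; apply: lt_trans; rewrite big_ord1 vE rmorphB ReD ReN.
  by rewrite arch_ratZ rmorph1 Re_ratM mulr1.
- by move: cN; rewrite /v_null; under eq_fun do rewrite big_ord1; rewrite (ord1 i).
Qed.

Lemma complex_completion_basis t : Im (u t) != 0 ->
  completion_basis v (fun (i : 'I_2) (n : nat) => if i == ord0 then 1 else t).
Proof.
move=> t0; set a := `|Im (u t)|.
have a0 : 0 < a by rewrite normr_gt0.
have vt0 : 0 <= v t by exact: cabs_ge0.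
split=> [i e e0|x xC|c cC cN].
- by exists 0%N => m n _ _; rewrite subrr /arch_abs rmorph0 ComplexField.Normc.normc0.
(* [r n] and [q n] are the coordinates of [u (x n)] in the real basis 1, [u t] of C. *)
- pose q n := Im (u (x n)) / Im (u t); pose r n := Re (u (x n)) - q n * Re (u t).
  have qB m n : `|q m - q n| <= v (x m - x n) / a.
    rewrite /q -mulrBl normrM normfV ler_pM2r ?invr_gt0 //.
    by rewrite -ImN -ImD -rmorphB normr_Im_le.
  have [|e1 [e1C e1x]] := cauchy_approx (r := q).
    move=> e e0; have [|N HN] := xC (e * a); first by rewrite mulr_gt0.
    exists N => m n Nm Nn; rewrite (le_lt_trans (qB m n)) // ltr_pdivrMr //.
    exact: HN.
  have [|e0 [e0C e0x]] := cauchy_approx (r := r).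
    move=> e e_gt0; pose M := 1 + `|Re (u t)| / a.
    have M0 : 0 < M by rewrite ltr_pwDl // divr_ge0 // ltW.
    have [|N HN] := xC (e / M); first by rewrite divr_gt0.
    exists N => m n Nm Nn; have := HN m n Nm Nn; rewrite ltr_pdivlMr //.
    apply: le_lt_trans.
    have -> : r m - r n = Re (u (x m - x n)) - (q m - q n) * Re (u t).
      by rewrite rmorphB ReD ReN /r; ring.
    rewrite (le_trans (ler_normB _ _)) // /M mulrDr mulr1 lerD ?normr_Re_le //.
    by rewrite normrM mulrA mulrAC ler_wpM2r.
  exists (fun i => if i == ord0 then e0 else e1); split=> [i|].
    by case: (i == ord0).
  apply/v_nullP => e e_gt0; pose M := 1 + v t.
  have M0 : 0 < M by rewrite ltr_pwDl.
  have [|N HN] := @invn_eventually R (e / M); first by rewrite divr_gt0.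
  exists N => n /HN; rewrite ltr_pdivlMr // => h.
  apply: le_lt_trans h; rewrite big_ord_recl big_ord1 /=.
  have -> : v (x n - (e0 n *: 1 + e1 n *: t)) =
      cabs ((r n - ratr (e0 n))%:C%C + (q n - ratr (e1 n))%:C%C * u t).
    rewrite /arch_abs rmorphB rmorphD !arch_ratZ rmorph1 mulr1 !ratrC; congr cabs.
    have uE : u (x n) = (r n)%:C%C + (q n)%:C%C * u t.
      rewrite /r /q; case: (u (x n)) => b1 b2; case: (u t) t0 => t1 t2 /= t20.
      by apply/eqP; rewrite eq_complex /=; apply/andP; split; apply/eqP; field.
    by rewrite uE !rmorphB /=; ring.
  rewrite (le_trans (cabsD _ _)) //.
  rewrite ComplexField.Normc.normcM /M mulrDr mulr1.
  have cR (w : R) : cabs w%:C%C = `|w| by rewrite /= expr0n addr0 sqrtr_sqr.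
  rewrite !cR lerD //; first exact/ltW/e0x.
  rewrite -/(v t) ler_wpM2r //; exact/ltW/e1x.
- have {}cN e : 0 < e -> exists N, forall n, (N <= n)%N ->
      v (c ord0 n *: 1 + c (lift ord0 ord0) n *: t) < e.
    move: cN => /v_nullP H /H[N HN]; exists N => n /HN.
    by rewrite big_ord_recl big_ord1.
  have c1 e : 0 < e -> exists N, forall n, (N <= n)%N ->
      `|ratr (c (lift ord0 ord0) n)| < e :> R.
    move=> e0; have [|N HN] := cN (e * a); first by rewrite mulr_gt0.
    exists N => n /HN h; rewrite -(ltr_pM2r a0); apply: le_lt_trans h.
    rewrite -normrM -Im_ratM.
    have -> : Im (ratr (c (lift ord0 ord0) n) * u t) = Im (u (c ord0 n *: 1 + c (lift ord0 ord0) n *: t)).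
      by rewrite rmorphD !arch_ratZ rmorph1 mulr1 ImD [ratr (c ord0 n)]ratrC /= add0r.
    exact: normr_Im_le.
  have c0 e : 0 < e -> exists N, forall n, (N <= n)%N -> `|ratr (c ord0 n)| < e :> R.
    move=> e0; pose M := 1 + v t.
    have M0 : 0 < M by rewrite ltr_pwDl.
    have [|N1 H1] := cN (e / 2); first by rewrite divr_gt0.
    have [|N2 H2] := c1 (e / 2 / M); first by rewrite !divr_gt0.
    exists (maxn N1 N2) => n; rewrite geq_max => /andP[/H1 h1 /H2 h2].
    rewrite -arch_rat; have -> : (c ord0 n)%:A =
        (c ord0 n *: 1 + c (lift ord0 ord0) n *: t) - c (lift ord0 ord0) n *: t :> K.
      by rewrite addrK.
    rewrite /arch_abs rmorphB (le_lt_trans (cabsD _ _)) //.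
    rewrite cabsN arch_ratZ ComplexField.Normc.normcM cabs_rat.
    rewrite ltr_pdivlMr // in h2.
    have h3 : `|ratr (c (lift ord0 ord0) n)| * cabs (u t) <= `|ratr (c (lift ord0 ord0) n)| * M.
      by rewrite ler_wpM2l // /M lerDr.
    rewrite /arch_abs in h1; lra.
  move=> i; apply/v_nullP => e e0.
  have [->|i0] := eqVneq i ord0.
    by have [N HN] := c0 _ e0; exists N => n /HN; rewrite arch_rat.
  have -> : i = lift ord0 ord0 by apply: val_inj; case: i i0 => -[|[|]].
  by have [N HN] := c1 _ e0; exists N => n /HN; rewrite arch_rat.
Qed.

(** The explicit bases show that [xget] has something to choose from, so the bounds below can argue
    with a basis of whatever size it returned. *)
Lemma completion_basis_local_degree :
  exists b : 'I_(local_degree v) -> nat -> K, completion_basis v b.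
Proof.
rewrite /local_degree.
apply: (@xgetPex _ 0%N [set d | exists b : 'I_d -> nat -> K, completion_basis v b]).
have [real_u|] := pselect (forall x, Im (u x) = 0).
  by exists 1%N; eexists; apply: real_completion_basis.
move=> /existsNP[t /eqP t0].
by exists 2%N; eexists; apply: (complex_completion_basis t0).
Qed.

Lemma v_const_cauchy x : v_cauchy v (fun=> x).
Proof.
by exists 0%N => m n _ _; rewrite subrr /arch_abs rmorph0 ComplexField.Normc.normc0.
Qed.

Lemma v_cauchy_bounded x : v_cauchy v x ->
  exists (M : R) (N : nat), 0 < M /\ forall n, (N <= n)%N -> v (x n) <= M.
Proof.
move=> /(_ 1 ltr01)[N HN]; exists (1 + v (x N)), N; split.
  by rewrite ltr_pwDl // cabs_ge0.
move=> n Nn; rewrite -{1}(subrK (x N) (x n)) /arch_abs rmorphD.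
rewrite (le_trans (cabsD _ _)) // lerD2r ltW //.
exact: HN.
Qed.

Lemma local_degree_gt0 : (0 < local_degree v)%N.
Proof.
have [b [_ bgen _]] := completion_basis_local_degree.
rewrite lt0n; apply/eqP => d0.
have [c [_ /v_nullP/(_ 1 ltr01)[N /(_ _ (leqnn N))]]] := bgen _ (v_const_cauchy 1).
rewrite big1 => [|i _]; last by have := ltn_ord i; rewrite [X in (_ < X)%N]d0.
by rewrite subr0 /arch_abs rmorph1 ComplexField.Normc.normc1 ltxx.
Qed.

(** If a single [b] generated, then 1 ~ c1 b and t ~ c2 b with rational c1, c2. So c1 t - c2 = c1 (t
    - c2 b) - c2 (1 - c1 b) would be small; its imaginary part forces c1 to be small, and then c1 b
    cannot be close to 1. *)
Lemma local_degree_gt1 t : Im (u t) != 0 -> (1 < local_degree v)%N.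
Proof.
move=> t0; have [b [bC bgen _]] := completion_basis_local_degree.
rewrite ltn_neqAle local_degree_gt0 andbT; apply/eqP => /esym d1.
move: b bC bgen; rewrite d1 => b bC bgen.
have [M [N [M0 bM]]] := v_cauchy_bounded (bC ord0).
have [c1 [c1C c1N]] := bgen _ (v_const_cauchy 1).
have [c2 [c2C c2N]] := bgen _ (v_const_cauchy t).
have [M1 [N1 [M10 c1M]]] := v_cauchy_bounded (c1C ord0).
have [M2 [N2 [M20 c2M]]] := v_cauchy_bounded (c2C ord0).
set a := `|Im (u t)|.
have a0 : 0 < a by rewrite normr_gt0.
move: c1N c2N => /v_nullP c1N /v_nullP c2N.
(* These tolerances give |k1| M <= 1/2 and |1 - k1 B| < 1/2, against 1 <= |1 - k1 B| + |k1| M. *)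
have [|N3 H3] := c1N (Num.min (1 / 2) (a / (4 * M * M2))).
  by rewrite lt_min !divr_gt0 // !mulr_gt0.
have [|N4 H4] := c2N (a / (4 * M * M1)).
  by rewrite !divr_gt0 // !mulr_gt0.
pose n := maxn (maxn N (maxn N1 N2)) (maxn N3 N4).
have [n0 n1 n2 n3 n4] : [/\ (N <= n)%N, (N1 <= n)%N, (N2 <= n)%N, (N3 <= n)%N & (N4 <= n)%N].
  by rewrite /n; split; rewrite !leq_max leqnn ?orbT.
have := H3 n n3; have := H4 n n4; rewrite !big_ord1.
have := c1M n n1; have := c2M n n2; have := bM n n0.
rewrite !arch_rat.
set k1 := c1 ord0 n; set k2 := c2 ord0 n; set B := b ord0 n.
move=> hb hk2 hk1 h4; rewrite lt_min => /andP[h3 h3'].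
have E : u (k1 *: t - k2 *: 1) = ratr k1 * u (t - k2 *: B) - ratr k2 * u (1 - k1 *: B).
  by rewrite !rmorphB !arch_ratZ !rmorph1; ring.
have h5 : `|ratr k1| * a <= M1 * v (t - k2 *: B) + M2 * v (1 - k1 *: B).
  rewrite -normrM -Im_ratM -arch_ratZ.
  have -> : Im (u (k1 *: t)) = Im (u (k1 *: t - k2 *: 1)).
    by rewrite rmorphB [u (k2 *: _)]arch_ratZ rmorph1 mulr1 ImD ImN [ratr k2]ratrC /= subr0.
  rewrite (le_trans (normr_Im_le _)) // E.
  rewrite (le_trans (cabsD _ _)) //.
  rewrite cabsN (ComplexField.Normc.normcM (ratr k1)) (ComplexField.Normc.normcM (ratr k2)) !cabs_rat.
  by rewrite lerD // ler_wpM2r // cabs_ge0.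
have h6 : M1 * v (t - k2 *: B) + M2 * v (1 - k1 *: B) <= a / (2 * M).
  have -> : a / (2 * M) = M1 * (a / (4 * M * M1)) + M2 * (a / (4 * M * M2)).
    by field; rewrite !gt_eqF.
  by rewrite lerD // ler_pM2l // ltW.
have h7 : `|ratr k1| * M <= 1 / 2 :> R.
  have := le_trans h5 h6; rewrite ler_pdivlMr ?mulr_gt0 //.
  have -> : `|ratr k1| * a * (2 * M) = (`|ratr k1| * M * 2) * a by ring.
  rewrite -[leRHS]mul1r ler_pM2r // => h; lra.
have : 1 <= v (1 - k1 *: B) + `|ratr k1| * M.
  rewrite -{1}(ComplexField.Normc.normc1 R) -{1}(rmorph1 u) -{1}(subrK (k1 *: B) 1) rmorphD.
  rewrite (le_trans (cabsD _ _)) // lerD2l arch_ratZ.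
  by rewrite ComplexField.Normc.normcM cabs_rat ler_wpM2l.
lra.
Qed.

End LocalDegree.

(** * Heights of integral elements *)

Section Places.
Variables (R : realType) (K : fieldExtType rat) (S : emb_system R K).
Local Notation d := (deg S).
Local Notation t := (gen S).
Local Notation s := (@emb R K S).
Local Notation OK := (ring_of_integers K).

Definition arch (j : 'I_d) : K -> R := arch_abs (s j).

(** This plays the role of n_v: 1 for a real embedding and 2 for a conjugate pair. It makes products
    over embeddings regroup into products over places. *)
Definition fib (j : 'I_d) : nat := #|[set k | arch k == arch j]%SET|.

(* A canonical embedding with the same absolute value; the fixed points of [rep]
   represent the archimedean places. *)
Definition rep (j : 'I_d) : 'I_d := odflt j [pick k | arch k == arch j].

Definition reps : {set 'I_d} := [set j | rep j == j]%SET.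

Lemma arch_rep j : arch (rep j) = arch j.
Proof. by rewrite /rep; case: pickP => [k /eqP|]. Qed.

Lemma rep_eq j k : (rep j == rep k) = (arch j == arch k).
Proof.
apply/eqP/eqP => [E|E]; first by rewrite -(arch_rep j) E arch_rep.
rewrite /rep; under eq_pick do rewrite E.
by case: pickP => // /(_ k); rewrite eqxx.
Qed.

Lemma rep_reps j : rep j \in reps.
Proof. by rewrite inE rep_eq arch_rep. Qed.

Lemma arch_inj : {in reps &, injective arch}.
Proof.
move=> j k; rewrite !inE => /eqP jr /eqP kr /eqP; rewrite -rep_eq => /eqP.
by rewrite jr kr.
Qed.

(** A complex number is determined up to conjugation by its distances to 0 and 1, here the absolute
    values of [t] and [t - 1]. *)
Lemma arch_eq_conj j k : arch k = arch j ->
  s k t = s j t \/ s k t = (s j t)^*%C.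
Proof.
move=> E.
have cab (q : rat) : cabs (s k t - ratr q) = cabs (s j t - ratr q).
  have := congr1 (fun f => f (t - q%:A)) E.
  by rewrite /arch /arch_abs !rmorphB /= !rmorph_ratZ !rmorph1 !mulr1.
have := congr1 (fun r => r ^+ 2) (cab 0); have := congr1 (fun r => r ^+ 2) (cab 1).
rewrite !cabs_sqr rmorph0 rmorph1 !subr0.
case: (s k t) (s j t) => [a b] [a' b'] /= h1 h0.
have {h1} aa : a = a'.
  have h1' : (a - 1) ^+ 2 + b ^+ 2 = (a' - 1) ^+ 2 + b' ^+ 2 by move: h1; rewrite !subr0.
  lra.
subst a'; have /eqP : b ^+ 2 = b' ^+ 2 by exact: (addrI _ h0).
by rewrite eqf_sqr => /orP[]/eqP ->; [left|right].
Qed.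

Lemma fib_le j : (fib j <= local_degree (arch j))%N.
Proof.
have inj : injective (fun k => s k t) by exact: emb_gen_inj.
rewrite /fib cardE; set A := enum _.
have sizeA (L : seq R[i]) : {subset [seq s k t | k <- A] <= L} -> (size A <= size L)%N.
  move=> subL; rewrite -(size_map (fun k => s k t)) uniq_leq_size //.
  by rewrite map_inj_uniq // enum_uniq.
have [t0|t0] := eqVneq (Im (s j t)) 0.
  rewrite (leq_trans _ (local_degree_gt0 (s j))) //.
  apply: (sizeA [:: s j t]) => _ /mapP[k + ->].
  rewrite mem_enum inE => /eqP E; rewrite !inE.
  have [->//|->] := arch_eq_conj E.
  by case: (s j t) t0 => a b /= ->; rewrite oppr0 eqxx.
rewrite (leq_trans _ (local_degree_gt1 t0)) //.
apply: (sizeA [:: s j t; (s j t)^*%C]) => _ /mapP[k + ->].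
rewrite mem_enum inE => /eqP E; rewrite !inE.
by have [->|->] := arch_eq_conj E; rewrite eqxx ?orbT.
Qed.

Lemma fib_gt0 j : (0 < fib j)%N.
Proof. by apply/card_gt0P; exists j; rewrite inE eqxx. Qed.

Lemma arch_ge0 j x : 0 <= arch j x.
Proof. exact: cabs_ge0. Qed.

Lemma prod_reps (f : 'I_d -> R) :
  (forall j, f (rep j) = f j) -> \prod_(j in reps) f j ^+ fib j = \prod_j f j.
Proof.
move=> frep; rewrite [RHS](partition_big rep (mem reps)) /=; last first.
  by move=> j _; exact: rep_reps.
apply: eq_bigr => j; rewrite inE => /eqP jr.
rewrite (eq_bigr (fun=> f j)); last by move=> k /eqP <-.
rewrite prodr_const; congr (_ ^+ _); apply: eq_card => k.
by rewrite inE -rep_eq jr.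
Qed.

(** Finite places contribute the factor 1 because [a] is integral, so the height is a product over
    [reps]; there [fib] is at most the local degree, and the bases are at least 1. *)
Lemma height_ge (a : OK) :
  \prod_(j in reps) Num.max 1 (arch j (int_val a)) ^+ fib j <= height R (int_val a).
Proof.
rewrite /height.
pose r := [seq arch j | j <- enum reps].
have rP (f : K -> R) : @places R K f -> f \notin r -> f (int_val a) <= 1.
  case=> [[u _ <-]|[p pP <-] _]; last exact: (padic_abs_le1 S).
  have [j uj] := emb_all S u.
  have -> : arch_abs u = arch j.
    by apply/funext => x; rewrite /arch /arch_abs uj.
  by rewrite -arch_rep map_f // mem_enum rep_reps.
rewrite (@fsbigE _ _ _ _ _ r).
- rewrite [leRHS]big_map big_enum_cond [leRHS]big_mkcondr /=; apply: ler_prod => j jr.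
  have -> : arch j \in @places R K by rewrite inE; left; exists (s j).
  have a0 := arch_ge0 j (int_val a).
  apply/andP; split; first by rewrite exprn_ge0 // le_max ler01.
  have [h|h] := leP (arch j (int_val a)) 1.
    by rewrite expr1n le_max lexx.
  rewrite le_max; apply/orP; right.
  by rewrite ler_weXn2l ?ltW // fib_le.
- by rewrite map_inj_in_uniq ?enum_uniq // => j k; rewrite !mem_enum; exact: arch_inj.
- by move=> f /mapP[j _ ->]; left; exists (s j).
- move=> f pf nf; have f1 := rP f pf nf.
  apply: max_l; rewrite exprn_ile1 //.
  case: pf => [[u _ <-]|[p _ <-]]; first exact: cabs_ge0.
  by rewrite /padic_abs; case: ifP => // _; apply: powR_ge0.
Qed.

Lemma emb_conj j : exists k, forall x, s k x = (s j x)^*.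
Proof.
have [k E] := emb_all S [the {rmorphism K -> R[i]} of Num.conj \o s j].
by exists k => x; rewrite -E.
Qed.

End Places.

(** * Minkowski's theorem by pigeonhole *)

(** Serves both for Minkowski's theorem and for the bound on independent units; in the j-th
    direction the box is cut into [N j] cells of width [w j]. *)
Lemma box_pigeonhole (R : realType) (T J : finType) (F : T -> J -> R) (N : J -> nat)
    (w : J -> R) :
  (forall j, 0 < w j) -> (forall a j, 0 <= F a j < (N j)%:R * w j) ->
  (\prod_j N j < #|T|)%N ->
  exists a b, a != b /\ forall j, `|F a j - F b j| <= w j.
Proof.
move=> w0 FN card.
have cell a j : (Num.truncn (F a j / w j) < N j)%N.
  have /andP[F0 F1] := FN a j.
  by rewrite truncn_lt_nat ?ltr_pdivrMr // divr_ge0 // ltW.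
pose h a : {dffun forall j, 'I_(N j)} := [ffun j => Ordinal (cell a j)].
have : ~ injective h.
  move=> /leq_card; rewrite leqNgt card_dep_ffun foldrE big_map big_enum /=.
  by under eq_bigr do rewrite card_ord; rewrite card.
move=> /injectiveP/injectivePn[a [b ab hab]].
exists a, b; split=> // j.
have : Num.truncn (F a j / w j) = Num.truncn (F b j / w j).
  by have := congr1 (fun g : {dffun forall j, 'I_(N j)} => val (g j)) hab; rewrite !ffunE.
have q0 c : 0 <= F c j / w j by have /andP[? _] := FN c j; rewrite divr_ge0 // ltW.
have := truncn_itv (q0 a); have := truncn_itv (q0 b) => /andP[h1 h2] /andP[h3 h4] E.
rewrite E in h3 h4.
rewrite -[leRHS]mul1r -ler_pdivrMr // -[X in _ / X](gtr0_norm (w0 j)) -normf_div.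
rewrite mulrBl ler_norml; rewrite -natr1 in h2 h4.
by apply/andP; split; lra.
Qed.

Section Minkowski.
Variables (R : realType) (K : fieldExtType rat) (S : emb_system R K).
Local Notation d := (deg S).
Local Notation t := (gen S).
Local Notation s := (@emb R K S).

Definition lat (c : 'rV[int]_d) : K := \sum_i (c 0 i)%:~R * t ^+ i.

Lemma lat_int c : intK (lat c).
Proof.
apply: integral_sumr => i; apply: integral_mul.
  exact: integral_id.
by apply: integral_expr; apply: gen_int.
Qed.

Lemma latB b c : lat (b - c) = lat b - lat c.
Proof. by rewrite -sumrB; apply: eq_bigr => i _; rewrite !mxE rmorphB mulrBl. Qed.

Lemma lat_eq0 c : (lat c == 0) = (c == 0).
Proof.
apply/eqP/eqP => [E|->]; last by rewrite /lat big1 // => i _; rewrite mxE mul0r.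
have /(coord_inj (S := S)) : \sum_i (map_mx intr c : 'rV[rat]_d) 0 i *: t ^+ i
    = \sum_i (0 : 'rV[rat]_d) 0 i *: t ^+ i.
  rewrite [RHS]big1 => [|i _]; last by rewrite mxE scale0r.
  by rewrite -[RHS]E; apply: eq_bigr => i _; rewrite mxE scaler_int mulrzl.
move=> E0; apply/rowP => i; have := congr1 (fun M : 'rV_d => M 0 i) E0.
by rewrite !mxE => /eqP; rewrite intr_eq0 => /eqP.
Qed.

(* The conjugate embedding gives Re - Im, so these [d] real functionals treat real
   and complex places uniformly. *)
Definition tf (j : 'I_d) (x : K) : R := Re (s j x) + Im (s j x).

Lemma tfB j x y : tf j (x - y) = tf j x - tf j y.
Proof. by rewrite /tf rmorphB ReD ImD ReN ImN; ring. Qed.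

Lemma tf_le j x : `|tf j x| <= 2 * cabs (s j x).
Proof.
rewrite /tf (le_trans (ler_normD _ _)) //.
have := normr_Re_le (s j x); have := normr_Im_le (s j x); lra.
Qed.

(** For [k] conjugate to [j] the two functionals are a + b and a - b, whose absolute values add up
    to 2 max(|a|, |b|). *)
Lemma arch_le_tf j : exists2 k, arch k = arch j &
  forall x, arch j x <= `|tf j x| + `|tf k x|.
Proof.
have [k kj] := emb_conj j; exists k.
  apply/funext => x; rewrite /arch /arch_abs kj.
  by apply: complexI; rewrite -!cabsE norm_conjC.
move=> x; rewrite /arch /arch_abs /tf kj.
apply: le_trans (cabs_le_ReIm _) _.
have -> : (s j x)^* = ((s j x)^*)%C by [].
case: (s j x) => a b /=.
have h1 : `|2 * a| <= `|a + b| + `|a - b|.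
  by rewrite (_ : 2 * a = (a + b) + (a - b)) ?ler_normD //; ring.
have h2 : `|2 * b| <= `|a + b| + `|a - b|.
  by rewrite (_ : 2 * b = (a + b) - (a - b)) ?ler_normB //; ring.
by move: h1 h2; rewrite !normrM (ger0_norm (ler0n R 2)); lra.
Qed.

(** The (M+1)^d lattice points with coordinates in 0..M have functionals bounded by B0 M. They fall
    in at most M^d cells of sides B_j once the product of the B_j reaches (4 B0)^d. *)
Lemma minkowski : exists2 C1 : R, 0 < C1 & forall B : 'I_d -> R,
  (forall j, 0 < B j) -> C1 <= \prod_j B j ->
  exists2 c : 'rV[int]_d, c != 0 & forall j, `|tf j (lat c)| <= B j.
Proof.
pose B0 : R := 1 + \sum_j \sum_(i < d) 2 * cabs (s j (t ^+ i)).
have sum0 j : 0 <= \sum_(i < d) 2 * cabs (s j (t ^+ i)).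
  by apply: sumr_ge0 => i _; rewrite mulr_ge0 ?cabs_ge0.
have B00 : 0 < B0 by rewrite ltr_pwDl ?sumr_ge0.
exists ((4 * B0) ^+ d); first by rewrite exprn_gt0 ?mulr_gt0.
move=> B Bgt0 BC.
(* [M] is large enough that 2 B0 M / B_j >= 1 for every [j]; rounding this quotient up to the cell
   count then at most doubles it, whence the 4 in the constant. *)
pose M := (Num.truncn (\sum_j B j / (2 * B0))).+1.
have MB j : B j <= 2 * B0 * M%:R.
  rewrite mulrC -ler_pdivrMr ?mulr_gt0 // ltW // (le_lt_trans _ (truncnS_gt _)) //.
  rewrite (bigD1 j) //= lerDl sumr_ge0 // => i _.
  by rewrite divr_ge0 ?mulr_ge0 ?ltW.
pose cf (f : {ffun 'I_d -> 'I_M.+1}) : 'rV[int]_d := \row_i (f i : nat)%:Z.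
have tfM f j : `|tf j (lat (cf f))| <= B0 * M%:R.
  have -> : tf j (lat (cf f)) = \sum_(i < d) (f i : nat)%:R * tf j (t ^+ i).
    transitivity (Re (\sum_(i < d) ratr (f i : nat)%:R * s j (t ^+ i)) +
       Im (\sum_(i < d) ratr (f i : nat)%:R * s j (t ^+ i))).
      rewrite /tf /lat rmorph_sum; congr (Re _ + Im _); apply: eq_bigr => i _;
      by rewrite mxE rmorphM /= rmorph_nat ratr_nat.
    rewrite (big_morph _ (@ReD R) (erefl : Re 0 = 0)).
    rewrite (big_morph _ (@ImD R) (erefl : Im 0 = 0)) -big_split /=.
    by apply: eq_bigr => i _; rewrite Re_ratM Im_ratM -mulrDr ratr_nat.
  rewrite (le_trans (ler_norm_sum _ _ _)) // mulrC.
  apply: (@le_trans _ _ (\sum_(i < d) M%:R * (2 * cabs (s j (t ^+ i))))).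
    apply: ler_sum => i _; rewrite normrM ler_pM ?tf_le // normr_nat ler_nat.
    by rewrite -ltnS.
  rewrite -mulr_sumr ler_wpM2l // /B0 [X in _ <= 1 + X](bigD1 j) //= addrCA lerDl addr_ge0 //.
  by apply: sumr_ge0.
pose N j := (Num.truncn (2 * B0 * M%:R / B j)).+1.
have M0 : 0 < M%:R :> R by rewrite ltr0n.
have [||f [g [fg Hfg]]] := @box_pigeonhole R _ _
    (fun f j => tf j (lat (cf f)) + B0 * M%:R) N B Bgt0.
- move=> f j; have := tfM f j; rewrite ler_norml => /andP[h1 h2].
  apply/andP; split; first lra.
  rewrite -ltr_pdivrMr // (le_lt_trans _ (truncnS_gt _)) // ler_pM2r ?invr_gt0 //; lra.
- rewrite card_ffun !card_ord -(ltr_nat R) natr_prod natrX.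
  apply: (@le_lt_trans _ _ (M%:R ^+ d)); last first.
    by rewrite ltrXn2r ?deg_gt0 -?lt0n ?deg_gt0 // ltr_nat.
  apply: (@le_trans _ _ (\prod_j (4 * B0 * M%:R / B j))).
    apply: ler_prod => j _; rewrite ler0n /N /= -natr1.
    have h : 0 <= 2 * B0 * M%:R / B j by rewrite divr_ge0 ?mulr_ge0 ?ltW.
    have /andP[h1 _] := truncn_itv h.
    have : 1 <= 2 * B0 * M%:R / B j by rewrite ler_pdivlMr // mul1r.
    have -> : 4 * B0 * M%:R / B j = 2 * B0 * M%:R / B j + 2 * B0 * M%:R / B j by ring.
    by move=> h2; rewrite lerD.
  rewrite big_split /= prodr_const card_ord prodfV ler_pdivrMr ?prodr_gt0 //.
  by rewrite exprMn mulrC ler_pM2l // exprn_gt0.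
exists (cf f - cf g).
  rewrite subr_eq0; apply: contra_neq fg => /rowP E; apply/ffunP => i.
  by apply: val_inj; have := E i; rewrite !mxE => -[].
by move=> j; rewrite latB tfB; have := Hfg j; rewrite opprD addrACA subrr addr0.
Qed.

End Minkowski.

(** * Units *)

Section Units.
Variables (R : realType) (K : fieldExtType rat) (S : emb_system R K).
Local Notation d := (deg S).
Local Notation t := (gen S).
Local Notation s := (@emb R K S).

Definition is_unit (x : K) := [/\ x != 0, x \in integral_pred K & x^-1 \in integral_pred K].

Lemma archM (j : 'I_d) x y : arch j (x * y) = arch j x * arch j y.
Proof. by rewrite /arch /arch_abs rmorphM ComplexField.Normc.normcM. Qed.

Lemma archV (j : 'I_d) x : arch j x^-1 = (arch j x)^-1.
Proof. by rewrite /arch /arch_abs fmorphV ComplexField.Normc.normcV. Qed.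

Lemma arch_gt0 (j : 'I_d) x : (0 < arch j x) = (x != 0).
Proof. by rewrite /arch /arch_abs cabs_gt0 fmorph_eq0. Qed.

Lemma arch_norm_ge1 (x : K) : intK x -> x != 0 -> 1 <= \prod_j arch (j : 'I_d) x.
Proof. exact: norm_ge1. Qed.

Lemma integral_of_emb (j : 'I_d) y : intK (s j y) -> intK y.
Proof.
case=> p monp rp; exists p => //; move: rp.
rewrite /root -(fmorph_eq0 (s j)) -horner_map -map_poly_comp.
move=> rp; have <- : map_poly (intr : int -> R[i]) p = map_poly (s j \o intr) p; last exact: rp.
by apply: eq_map_poly => n /=; rewrite rmorph_int.
Qed.

(** The norm of [x] is an integer of size at most [C], so it divides the factorial, and its quotient
    by [x] is, under an embedding, the product of the other conjugates. *)
Lemma fact_div_integral (C : R) (x : K) : intK x -> x != 0 ->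
  \prod_j arch (j : 'I_d) x <= C -> intK ((Num.truncn C)`!%:R / x).
Proof.
move=> ix x0 nC; have [m Em] := emb_prod_int S ix.
have absm : \prod_j arch (j : 'I_d) x = (absz m)%:R.
  by rewrite -cabs_prod Em cabs_int -abszE.
have m1 : (0 < absz m)%N.
  by rewrite -(ltr_nat R) -absm (lt_le_trans ltr01) // arch_norm_ge1.
have mC : (absz m <= Num.truncn C)%N.
  by rewrite truncn_ge_nat ?(le_trans _ nC) -?absm // (le_trans ler01) // arch_norm_ge1.
have /dvdnP[q ->] : (absz m %| (Num.truncn C)`!)%N by apply: dvdn_fact; rewrite m1.
rewrite natrM -mulrA; apply: integral_mul; first exact: integral_nat.
have im : intK (m%:~R / x).
  apply: (integral_of_emb (j := Ordinal (deg_gt0 S))).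
  rewrite rmorphM fmorphV rmorph_int -Em (bigD1 (Ordinal (deg_gt0 S))) //= mulrAC.
  rewrite divff ?mul1r ?fmorph_eq0 // big_mkcond.
  apply: integral_prodr => i; case: ifP => _; last exact: mxpoly.integral1.
  exact: integral_emb.
have [->|->] : (absz m)%:R = m%:~R :> K \/ (absz m)%:R = - m%:~R :> K.
- by case: m {Em absm m1 mC im} => n; [left|right]; rewrite // NegzE mulrNz opprK.
- exact: im.
- by rewrite mulNr; apply: integral_opp.
Qed.

Lemma ratio_integral (C : R) (x y : K) (c : 'rV[int]_d) : intK x -> x != 0 ->
  \prod_j arch (j : 'I_d) x <= C ->
  y = x + (Num.truncn C)`!%:R * lat c -> intK (y / x).
Proof.
move=> ix x0 nC ->; rewrite mulrDl divff // mulrAC.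
apply: integral_add; first exact: mxpoly.integral1.
by apply: integral_mul; [exact: fact_div_integral|exact: lat_int].
Qed.

(* Minkowski's theorem gives integers [x n] of bounded norm that decrease with [n]
   at all places but that of [j0]. Two of them are congruent modulo a common
   multiple [Q] of all their norms; as [Q / x n] is integral, so is their ratio. *)
Lemma special_unit (j0 : 'I_d) :
  exists2 u, is_unit u & forall j : 'I_d, arch j != arch j0 -> arch j u < 1.
Proof.
have [C1 C10 mink] := minkowski S.
pose m := fib j0; pose k := (d - m)%N; pose g := 1 + C1.
have g1 : 1 <= g by rewrite /g lerDl ltW.
have g0 : 0 < g by rewrite (lt_le_trans ltr01).
have m_gt0 : (0 < m)%N by exact: fib_gt0.
pose Cn := 2 ^+ d * g ^+ m.
have Cn1 : 1 <= Cn by rewrite -[1]mulr1 ler_pM // exprn_ege1 // ler1n.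
(* At each place [x n] will lie between 2 B / Cn and 2 B, the lower bound because its norm is at
   least 1. As mu > Cn, a drop of [B] by a factor [mu] forces a strict drop of [x n]. *)
pose mu := 1 + Cn.
have mu1 : 1 <= mu by rewrite /mu lerDl (le_trans ler01).
have mu0 : 0 < mu by rewrite (lt_le_trans ltr01).
pose A := [set j : 'I_d | arch j == arch j0]%SET.
(* The powers of [mu] cancel between the [m] embeddings in [A] and the [k] others, so the product
   stays g^m >= C1 for all [n]. *)
pose B n (j : 'I_d) := if j \in A then g * mu ^+ (n * k) else mu ^- (n * m).
have B0 n j : 0 < B n j.
  by rewrite /B; case: ifP => _; rewrite ?mulr_gt0 ?invr_gt0 ?exprn_gt0.
have BE n : \prod_j B n j = g ^+ m.
  rewrite (bigID (mem A)) /= (eq_bigr (fun=> g * mu ^+ (n * k))); last first.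
    by move=> j h; rewrite /B h.
  rewrite [X in _ * X](eq_bigr (fun=> mu ^- (n * m))); last first.
    by move=> j h; rewrite /B (negbTE h).
  rewrite [X in _ * X](eq_bigl (mem (~: A)%SET)); last by move=> j; rewrite /= finset.in_setC.
  rewrite !prodr_const; have -> : #|(~: A)%SET| = k.
    have h : (m + #|(~: A)%SET| = d)%N by have := cardsC A; rewrite card_ord.
    by apply: (@addnI m); rewrite h subnKC // -[leqRHS]h leq_addr.
  rewrite -/m exprMn -mulrA -exprVn -!exprM exprVn.
  have -> : (n * k * m = n * m * k)%N by rewrite mulnAC.
  by rewrite divff ?mulr1 // expf_neq0 ?gt_eqF.
have gm : C1 <= g ^+ m.
  by rewrite (@le_trans _ _ g) ?lerDr // -[leLHS]expr1 ler_weXn2l.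
have ex n : exists2 c : 'rV[int]_d, c != 0 & forall j, `|tf j (lat c)| <= B n j.
  by apply: mink => //; rewrite BE.
pose c n := s2val (cid2 (ex n)); pose x n := lat (c n).
have x0 n : x n != 0 by rewrite lat_eq0 (s2valP (cid2 (ex n))).
have ix n : intK (x n) by exact: lat_int.
have xB n (j : 'I_d) : arch j (x n) <= 2 * B n j.
  have [l lj le_j] := arch_le_tf j; rewrite (le_trans (le_j _)) //.
  have Bl : B n l = B n j by rewrite /B !inE lj.
  have h := s2valP' (cid2 (ex n)); have := h j; have := h l; rewrite Bl -/(c n) -/(x n).
  by move=> h1 h2; rewrite mulr_natl mulr2n lerD.
have normC n : \prod_j arch (j : 'I_d) (x n) <= Cn.
  apply: (@le_trans _ _ (\prod_j (2 * B n j))).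
    by apply: ler_prod => j _; rewrite arch_ge0 xB.
  by rewrite big_split /= prodr_const card_ord BE.
have x_lower n (j : 'I_d) : 2 * B n j / Cn <= arch j (x n).
  have prod2 : 2 * B n j * \prod_(i < d | i != j) (2 * B n i) = Cn.
    by rewrite /Cn -(BE n) -[X in 2 ^+ X]card_ord -prodr_const -big_split [RHS](bigD1 j).
  rewrite ler_pdivrMr ?(lt_le_trans ltr01) // -prod2.
  have P0 : 0 < \prod_(i < d | i != j) (2 * B n i).
    by apply: prodr_gt0 => i _; rewrite mulr_gt0.
  rewrite mulrCA; apply: ler_peMr; first by rewrite mulr_ge0 // ltW.
  rewrite (le_trans (arch_norm_ge1 (ix n) (x0 n))) // (bigD1 j) //=.
  rewrite ler_wpM2l ?arch_ge0 //; apply: ler_prod => i _.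
  by rewrite arch_ge0 xB.
have decr n n' (j : 'I_d) : (n < n')%N -> arch j != arch j0 -> arch j (x n') < arch j (x n).
  move=> nn' jj0; apply: le_lt_trans (xB _ _) _.
  apply: lt_le_trans (x_lower n j); rewrite /B !inE (negbTE jj0).
  rewrite -mulrA ltr_pM2l // ltr_pdivlMr ?(lt_le_trans ltr01) //.
  have -> : mu ^- (n * m) = mu ^- (n' * m) * mu ^+ ((n' - n) * m).
    rewrite mulnBl expfB ?ltn_mul2r ?m_gt0 //.
    by rewrite mulKf // expf_neq0 // gt_eqF.
  rewrite ltr_pM2l ?invr_gt0 ?exprn_gt0 // (@lt_le_trans _ _ mu) //.
    by rewrite /mu ltrDr.
  by rewrite -[leLHS]expr1 ler_weXn2l // muln_gt0 subn_gt0 nn'.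
pose Q := (Num.truncn Cn)`!.
have Q0 : (0 < Q)%N by exact: fact_gt0.
have Q0z : Q%:Z != 0 by rewrite eqz_nat -lt0n.
have rlt n (i : 'I_d) : (absz (modz (c n 0%R i) Q%:Z) < Q)%N.
  rewrite -ltz_nat gez0_abs ?modz_ge0 //.
  by have := ltz_mod (c n 0 i) Q0z; rewrite ger0_norm.
pose rho n : {ffun 'I_d -> 'I_Q} := [ffun i => Ordinal (rlt n i)].
have [n [n' [nn' rE]]] : exists n n', (n < n')%N /\ rho n = rho n'.
  have : ~ injective (fun n : 'I_#|{: {ffun 'I_d -> 'I_Q}}|.+1 => rho n).
    by move=> /leq_card; rewrite card_ord ltnn.
  move=> /injectiveP/injectivePn[a [b ab E]].
  case: (ltngtP a b) => [h|h|/val_inj h]; first by exists a, b.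
    by exists b, a.
  by rewrite h eqxx in ab.
pose e : 'rV[int]_d := \row_i divz (c n' 0 i - c n 0 i) Q%:Z.
have cE : c n' - c n = Q%:Z *: e.
  apply/rowP => i; rewrite !mxE mulrC divzK // -eqz_mod_dvd; apply/eqP.
  have := congr1 (fun f : {ffun 'I_d -> 'I_Q} => (f i : nat)%:Z) rE.
  by rewrite !ffunE /= !gez0_abs ?modz_ge0.
have lE : x n' - x n = Q%:R * lat e.
  rewrite -latB cE /lat mulr_sumr; apply: eq_bigr => i _.
  by rewrite mxE rmorphM mulrA.
exists (x n' / x n).
  split; first by rewrite mulf_neq0 ?invr_neq0.
    apply/asboolP; apply: (ratio_integral (C := Cn) (c := e)) => //.
    by rewrite -lE addrC subrK.
  apply/asboolP; rewrite invf_div; apply: (ratio_integral (C := Cn) (c := - e)) => //.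
  rewrite -sub0r latB mulrBr -lE (_ : lat (0 : 'rV_d) = 0) ?mulr0; first by ring.
  by apply/eqP; rewrite lat_eq0.
move=> j jj0; rewrite archM archV ltr_pdivrMr ?mul1r ?arch_gt0 //.
exact: decr.
Qed.

End Units.

(** * Logarithms of units and independence *)

Section UnitRank.
Variables (R : realType) (K : fieldExtType rat) (S : emb_system R K).
Local Notation d := (deg S).
Local Notation s := (@emb R K S).

Definition logv (j : 'I_d) (x : K) : R := ln (arch j x).

Lemma logvM j x y : x != 0 -> y != 0 -> logv j (x * y) = logv j x + logv j y.
Proof. by move=> x0 y0; rewrite /logv archM lnM ?posrE ?arch_gt0. Qed.

Lemma logvV j x : x != 0 -> logv j x^-1 = - logv j x.
Proof. by move=> x0; rewrite /logv archV lnV ?posrE ?arch_gt0. Qed.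

Lemma logv1 j : logv j 1 = 0.
Proof. by rewrite /logv /arch /arch_abs rmorph1 ComplexField.Normc.normc1 ln1. Qed.

Lemma logv_exprz j x (m : int) : x != 0 -> logv j (x ^ m) = m%:~R * logv j x.
Proof.
move=> x0; have Hn n : logv j (x ^+ n) = n%:R * logv j x.
  elim: n => [|n IH]; first by rewrite expr0 logv1 mul0r.
  by rewrite exprS logvM ?expf_neq0 // IH -natr1 mulrDl mul1r addrC.
case: m => n; first exact: Hn.
by rewrite NegzE -exprnN logvV ?expf_neq0 // Hn mulrNz mulNr.
Qed.

Lemma logv_prod j (I : finType) (f : I -> K) :
  (forall i, f i != 0) -> logv j (\prod_i f i) = \sum_i logv j (f i).
Proof.
move=> f0; apply: (proj2 (_ : \prod_i f i != 0 /\ _)).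
apply: (big_rec2 (fun x y => x != 0 /\ logv j x = y)).
  by rewrite oner_eq0 logv1.
by move=> i y x _ [x0 <-]; rewrite mulf_neq0 ?f0 // logvM.
Qed.

Lemma sum_logv_ge0 x : intK x -> x != 0 -> 0 <= \sum_j logv j x.
Proof.
move=> ix x0; have := arch_norm_ge1 S ix x0.
have -> : \sum_j logv j x = ln (\prod_j arch (j : 'I_d) x).
  apply: esym; apply: (proj2 (_ : 0 < \prod_j arch (j : 'I_d) x /\ _)).
  apply: (big_rec2 (fun y z => 0 < y /\ ln y = z)); first by rewrite ltr01 ln1.
  by move=> i y z _ [z0 <-]; rewrite mulr_gt0 ?arch_gt0 // lnM ?posrE ?arch_gt0.
exact: ln_ge0.
Qed.

(* Sum the relations over the places [w i] with [m i > 0]: since the logarithms of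
   each [u i] have nonnegative sum, every term is nonnegative, some positive. *)
Lemma relation_nonpos (I : finType) (w : I -> 'I_d) (v0 : 'I_d) (u : I -> K) (m : I -> int) :
  (forall i, intK (u i) /\ u i != 0) ->
  (forall i (j : 'I_d), arch j != arch (w i) -> arch j (u i) < 1) ->
  (forall i i', arch (w i) = arch (w i') -> i = i') ->
  (forall i, arch v0 != arch (w i)) ->
  (forall j, \sum_i (m i)%:~R * logv j (u i) = 0) -> forall i, (m i <= 0)%R.
Proof.
move=> iu small winj v0w rel i0; rewrite leNgt; apply/negP => mi0.
pose J := [set j : 'I_d | [exists i, (0 < m i)%R && (arch j == arch (w i))]]%SET.
have neg i j : arch j != arch (w i) -> logv j (u i) < 0.
  by move=> /small h; apply: ln_lt0; rewrite h arch_gt0 (iu i).2.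
have : 0 < \sum_(j in J) \sum_i (m i)%:~R * logv j (u i).
  rewrite exchange_big (bigD1 i0) //=; apply: ltr_pwDl.
    rewrite -mulr_sumr mulr_gt0 ?ltr0z //.
    have := sum_logv_ge0 (iu i0).1 (iu i0).2.
    rewrite (bigID (mem J)) /= => h.
    suff h' : \sum_(j | j \notin J) logv j (u i0) < 0 by lra.
    have negJ j : j \notin J -> logv j (u i0) < 0.
      rewrite inE negb_exists => /forallP/(_ i0); rewrite mi0 /= => h'; exact: neg.
    (* The spare place [v0] keeps the complement of [J] nonempty, which makes the inequality for
       [i0] strict. *)
    have v0J : v0 \notin J.
      rewrite inE negb_exists; apply/forallP => i; rewrite negb_and.
      by rewrite (v0w i) orbT.
    rewrite (bigD1 v0) //=; apply: ltr_nwDl; first exact: negJ.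
    by apply: sumr_le0 => j /andP[/negJ/ltW].
  apply: sumr_ge0 => i _; have [mi|mi] := ltP 0%R (m i); last first.
    rewrite -mulr_sumr mulr_le0 ?lerz0 //; apply: sumr_le0 => j.
    rewrite inE => /existsP[i' /andP[mi' /eqP E]]; apply/ltW/neg.
    by apply/eqP; rewrite E => /winj E'; move: mi'; rewrite E' ltNge mi.
  rewrite -mulr_sumr mulr_ge0 ?ler0z ?(ltW mi) //.
  have h := sum_logv_ge0 (iu i).1 (iu i).2; rewrite (bigID (mem J)) /= in h.
  have h' : \sum_(j | j \notin J) logv j (u i) <= 0.
    apply: sumr_le0 => j; rewrite inE negb_exists => /forallP/(_ i).
    by rewrite mi /= => h'; exact/ltW/neg.
  by rewrite (le_trans h) // gerDl.
by rewrite big1 ?ltxx // => j _; apply: rel.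
Qed.

(** One special unit is taken for each archimedean place except [v0]. Applying [relation_nonpos] to
    the exponents of a relation and to their opposites makes them all vanish. *)
Lemma exists_indep_units : exists u : 'I_(#|reps S|.-1) -> K, indep_units u.
Proof.
have r0 : (0 < #|reps S|)%N.
  by apply/card_gt0P; exists (rep (Ordinal (deg_gt0 S))); exact: rep_reps.
pose W : seq 'I_d := enum (reps S).
have sW : size W = #|reps S| by rewrite -cardE.
pose z := Ordinal (deg_gt0 S); pose v0 := nth z W 0.
pose w (i : 'I_(#|reps S|.-1)) := nth z W i.+1.
have wsz (i : 'I_(#|reps S|.-1)) : (i.+1 < size W)%N.
  by rewrite sW -[X in (_ < X)%N](prednK r0) ltnS.
have winj n n' : (n < size W)%N -> (n' < size W)%N ->
    arch (nth z W n) = arch (nth z W n') -> n = n'.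
  move=> nW nW' /arch_inj E; apply/eqP.
  rewrite -(nth_uniq z nW nW' (enum_uniq _)) E //.
    by rewrite -mem_enum mem_nth.
  by rewrite -mem_enum mem_nth.
have ex i := special_unit (w i).
pose u i := s2val (cid2 (ex i)).
have uP i : is_unit (u i) := s2valP (cid2 (ex i)).
have uS i := s2valP' (cid2 (ex i)).
exists u; split=> [i|m prod1 i]; first exact: uP.
have u0 k : u k != 0 by case: (uP k).
have rel j : \sum_k (m k)%:~R * logv j (u k) = 0.
  have := congr1 (logv j) prod1; rewrite logv1 logv_prod => [E|k].
    by rewrite -[RHS]E; apply: eq_bigr => k _; rewrite logv_exprz.
  exact: expfz_neq0.
have claim := @relation_nonpos _ w v0 u.
apply/eqP; rewrite eq_le; apply/andP; split.
  apply: claim rel _ => //.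
  - by move=> k; split=> //; case: (uP k) => _ /asboolP.
  - by move=> k k' /(winj _ _ (wsz _) (wsz _))[E]; apply: val_inj.
  - move=> k; apply/eqP => /winj E.
    by have := E (leq_ltn_trans (leq0n _) (wsz k)) (wsz k).
rewrite -oppr_le0.
apply: (claim (fun k => - m k)) => //.
- by move=> k; split=> //; case: (uP k) => _ /asboolP.
- by move=> k k' /(winj _ _ (wsz _) (wsz _))[E]; apply: val_inj.
- move=> k; apply/eqP => /winj E.
  by have := E (leq_ltn_trans (leq0n _) (wsz k)) (wsz k).
- move=> j; transitivity (- \sum_k (m k)%:~R * logv j (u k)); last by rewrite rel oppr0.
  rewrite -sumrN; apply: eq_bigr => k _.
  by rewrite rmorphN mulNr.
Qed.

End UnitRank.

(** * Boundedness of independent families of units *)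

Section Phase.
Variable R : realType.
Implicit Types (x y : R[i]).

Definition phase x : R[i] := x / (cabs x)%:C%C.

Lemma cabsC (r : R) : cabs r%:C%C = `|r|.
Proof. by rewrite /= expr0n addr0 sqrtr_sqr. Qed.

Lemma cabs_phase x : x != 0 -> cabs (phase x) = 1.
Proof.
move=> x0; rewrite /phase ComplexField.Normc.normcM ComplexField.Normc.normcV cabsC.
by rewrite ger0_norm ?cabs_ge0 // divff // cabs_eq0.
Qed.

Lemma phaseE x : x != 0 -> x = (cabs x)%:C%C * phase x.
Proof.
move=> x0; rewrite /phase mulrCA divff ?mulr1 //.
by rewrite (fmorph_eq0 (@real_complex R)) cabs_eq0.
Qed.

Lemma ratio_near1 (x y : R) : 0 < x -> 0 < y -> `|ln x - ln y| <= 8^-1 -> `|x - y| <= y / 7.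
Proof.
move=> x0 y0; rewrite ler_norml => /andP[h1 h2].
(* From exp h >= 1 + h with h >= -1/8; used in both directions it puts [x] between 7/8 y and 8/7
   y. *)
have lower (a b : R) : 0 < a -> 0 < b -> ln b - ln a <= 8^-1 -> 7 / 8 * b <= a.
  move=> a0 b0 h; rewrite -ler_pdivlMr // -[leRHS]lnK ?posrE ?divr_gt0 //.
  by apply: le_trans (expR_ge1Dx _); rewrite ln_div ?posrE //; move: (ln a) (ln b) h => ? ?; lra.
have := lower _ _ x0 y0; have := lower _ _ y0 x0.
have -> : ln x - ln y <= 8^-1 by [].
have -> : ln y - ln x <= 8^-1 by move: (ln x) (ln y) h1 => ? ?; lra.
move=> /(_ isT) h3 /(_ isT) h4.
by rewrite ler_norml; apply/andP; split; lra.
Qed.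

(** Splitting x - y into a change of modulus and a change of phase bounds it by (1/7 + 1/4) |y|. *)
Lemma phase_near1 x y : x != 0 -> y != 0 ->
  `|ln (cabs x) - ln (cabs y)| <= 8^-1 ->
  `|Re (phase x) - Re (phase y)| <= 8^-1 -> `|Im (phase x) - Im (phase y)| <= 8^-1 ->
  cabs (x / y - 1) < 1.
Proof.
move=> x0 y0 hl hr hi.
have y0' : 0 < cabs y by rewrite cabs_gt0.
have -> : x / y - 1 = (x - y) / y by rewrite mulrBl divff.
rewrite ComplexField.Normc.normcM ComplexField.Normc.normcV ltr_pdivrMr // mul1r.
have -> : x - y = (cabs x - cabs y)%:C%C * phase x + (cabs y)%:C%C * (phase x - phase y).
  by rewrite {1}(phaseE x0) {1}(phaseE y0) rmorphB /=; ring.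
apply: le_lt_trans (cabsD _ _) _.
rewrite (ComplexField.Normc.normcM _ (phase x)) (ComplexField.Normc.normcM _ (_ - _)).
rewrite !cabsC cabs_phase // mulr1 (gtr0_norm y0').
have h1 := ratio_near1 (etrans (cabs_gt0 x) x0) y0' hl.
have h2 : cabs (phase x - phase y) <= 1 / 4.
  apply: le_trans (cabs_le_ReIm _) _; rewrite ReD ReN ImD ImN.
  have -> : 1 / 4 = 8^-1 + 8^-1 :> R by field.
  exact: lerD.
have h3 : cabs y * cabs (phase x - phase y) <= cabs y * (1 / 4) by rewrite ler_pM2l.
move: h1 h3 y0'; move: (`|cabs x - cabs y|) (cabs (phase x - phase y)) (cabs y) => a b c.
by move: (c * b) => cb; lra.
Qed.

End Phase.

Section UnitRankBound.
Variables (R : realType) (K : fieldExtType rat) (S : emb_system R K).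
Local Notation d := (deg S).
Local Notation s := (@emb R K S).

Lemma integral_small_eq0 (x : K) : intK x -> (forall j : 'I_d, arch j x < 1) -> x = 0.
Proof.
move=> ix small; apply/eqP; apply: contraT => x0.
have := arch_norm_ge1 S ix x0; rewrite (bigD1 (Ordinal (deg_gt0 S))) //= leNgt => /negP[].
apply: le_lt_trans (small (Ordinal (deg_gt0 S))).
rewrite ler_piMr ?arch_ge0 //; apply: prodr_ile1 => j _.
by rewrite arch_ge0 ltW.
Qed.

(** x / y - 1 is integral and smaller than 1 at every embedding, so its norm is smaller than 1 and
    it is 0. *)
Lemma unit_near_eq (x y : K) : is_unit x -> is_unit y ->
  (forall j : 'I_d, [/\ `|logv j x - logv j y| <= 8^-1,
    `|Re (phase (s j x)) - Re (phase (s j y))| <= 8^-1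
    & `|Im (phase (s j x)) - Im (phase (s j y))| <= 8^-1]) -> x = y.
Proof.
move=> [x0 /asboolP ix _] [y0 _ /asboolP iy] near.
suff : x / y - 1 = 0 by move/eqP; rewrite subr_eq0 => /eqP/divr1_eq.
apply: integral_small_eq0.
  by apply: integral_sub; [exact: integral_mul|exact: mxpoly.integral1].
move=> j; have [h1 h2 h3] := near j.
rewrite /arch /arch_abs rmorphB rmorph1 rmorphM fmorphV.
by apply: phase_near1; rewrite ?fmorph_eq0.
Qed.

Lemma is_unit_prod (I : finType) (f : I -> K) :
  (forall i, is_unit (f i)) -> is_unit (\prod_i f i).
Proof.
move=> uf; apply: (big_ind (fun x : K => is_unit x)) => //.
  by split; rewrite ?oner_eq0 ?invr1 //; apply/asboolP; exact: mxpoly.integral1.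
move=> x y [x0 /asboolP ix /asboolP ix'] [y0 /asboolP iy /asboolP iy'].
split; first by rewrite mulf_neq0.
  by apply/asboolP; apply: integral_mul.
by apply/asboolP; rewrite invfM; apply: integral_mul.
Qed.

Lemma is_unit_exp (x : K) n : is_unit x -> is_unit (x ^+ n).
Proof.
move=> [x0 /asboolP ix /asboolP ix']; split; first exact: expf_neq0.
  by apply/asboolP; apply: integral_expr.
by apply/asboolP; rewrite -exprVn; apply: integral_expr.
Qed.

(* Among the products of the [u i] with exponents at most [M], two have the same
   logarithms and phases up to 1/8 at every embedding, hence are equal. *)
Lemma indep_units_le n (u : 'I_n -> K) : indep_units u -> (n <= d)%N.
Proof.
move=> [uP indep]; rewrite leqNgt; apply/negP => dn.
pose L : R := 1 + \sum_(j : 'I_d) \sum_i `|logv j (u i)|.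
have L1 : 1 <= L by rewrite lerDl sumr_ge0 // => j _; rewrite sumr_ge0.
have L0 : 0 <= L := le_trans ler01 L1.
(* Cells of width 1/8 per embedding: 17 for each of the two phase coordinates, 17 * 17 = 289, and at
   most 16 M L + 1 <= 17 L (M+1) for the logarithm. So there are at most (q L (M+1))^d cells, fewer
   than (M+1)^(d+1) as M exceeds (q L)^d. [q] is kept opaque to stop the numeral from being
   computed. *)
have [q q0 qE] : exists2 q : R, 0 <= q & q = 17 * 289.
  by exists (17 * 289); rewrite // mulr_ge0.
pose c : R := (q * L) ^+ d.
pose M := (Num.truncn c).+1.
pose U (f : {ffun 'I_n -> 'I_M.+1}) := \prod_i u i ^+ f i.
have Uu f : is_unit (U f) by apply: is_unit_prod => i; apply: is_unit_exp; exact: uP.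
have U0 f : U f != 0 by case: (Uu f).
have logU f (j : 'I_d) : `|logv j (U f)| <= M%:R * L.
  have u0 i : u i != 0 by case: (uP i).
  rewrite logv_prod => [|i]; last by rewrite expf_neq0.
  rewrite (le_trans (ler_norm_sum _ _ _)) //.
  apply: (@le_trans _ _ (\sum_i M%:R * `|logv j (u i)|)).
    apply: ler_sum => i _; rewrite exprnP logv_exprz // normrM ler_wpM2r //.
    by rewrite -[(_)%:~R]/((f i)%:R) normr_nat ler_nat -ltnS.
  rewrite -mulr_sumr ler_wpM2l // /L [X in 1 + X](bigD1 j) //= addrCA lerDl addr_ge0 //.
  by rewrite sumr_ge0 // => k _; rewrite sumr_ge0.
pose N0 := (Num.truncn (16 * M%:R * L)).+1.
pose F f (p : 'I_d * 'I_3) : R :=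
  [:: logv p.1 (U f) + M%:R * L; Re (phase (s p.1 (U f))) + 1; Im (phase (s p.1 (U f))) + 1]`_p.2.
pose N (p : 'I_d * 'I_3) := nth 0%N [:: N0; 17; 17] p.2.
have phb f j : `|Re (phase (s j (U f)))| <= 1 /\ `|Im (phase (s j (U f)))| <= 1.
  have h : cabs (phase (s j (U f))) = 1 by rewrite cabs_phase ?fmorph_eq0.
  by split; rewrite -[leRHS]h; [exact: normr_Re_le|exact: normr_Im_le].
have aux (a : R) : `|a| <= 1 -> 0 <= a + 1 < 17%:R * 8^-1.
  by rewrite ler_norml => /andP[h1 h2]; apply/andP; split; lra.
have [|f p||f [g [fg near]]] := @box_pigeonhole R _ _ F N (fun=> 8^-1).
- by [].
- case: p => j [[|[|[|//]]] i3]; rewrite /F /N /=; last first.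
  + by apply: aux; case: (phb f j).
  + by apply: aux; case: (phb f j).
  have := logU f j; rewrite ler_norml => /andP[h1 h2]; apply/andP; split.
    by rewrite -(opprK (M%:R * L)) subr_ge0.
  have h3 := truncnS_gt (16 * M%:R * L).
  rewrite ltr_pdivlMr //; apply: le_lt_trans h3.
  move: h2; move: (logv j (U f)) (M%:R * L) (mulrA 16 M%:R L) => a b <- h2.
  lra.
- rewrite card_ffun !card_ord -(ltr_nat R).
  have -> : (\prod_p N p = (N0 * 289) ^ d)%N.
    rewrite -(pair_bigA _ (fun j k => N (j, k))) /=.
    rewrite (eq_bigr (fun=> N0 * 289)%N) ?prod_nat_const ?card_ord // => j _.
    by rewrite !big_ord_recl big_ord0 /N /= muln1.
  have M1 : 1 <= M.+1%:R :> R by rewrite ler1n.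
  have N0le : (N0 * 289)%:R <= q * L * M.+1%:R.
    have h : 0 <= 16 * M%:R * L by rewrite !mulr_ge0.
    have /andP[h1 _] := truncn_itv h.
    rewrite natrM /N0 -natr1; move: (Num.truncn (16 * M%:R * L))%:R h1 => a h1.
    have h2 : 1 <= L * M.+1%:R by apply: le_trans L1 _; rewrite ler_peMr.
    have h3 : M%:R * L <= L * M.+1%:R by rewrite mulrC ler_wpM2l ?ler_nat.
    rewrite -mulrA in h1; rewrite -(mulrA q) qE.
    move: h1 h2 h3; move: (M%:R * L) (L * M.+1%:R) => b e h1 h2 h3; lra.
  move: (N0 * 289)%N N0le => T N0le.
  rewrite !natrX; apply: (@le_lt_trans _ _ ((q * L * M.+1%:R) ^+ d)).
    rewrite lerXn2r // nnegrE ?ler0n //.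
    by rewrite !mulr_ge0.
  rewrite exprMn -/c; apply: (@lt_le_trans _ _ (M.+1%:R ^+ d.+1)).
    rewrite exprS ltr_pM2r ?exprn_gt0 ?ltr0n //.
    by rewrite (lt_le_trans (truncnS_gt _)) // ler_nat.
  by rewrite ler_weXn2l.
have Ufg : U f = U g.
  apply: unit_near_eq => // j; split.
  - by have := near (j, ord0); rewrite /F /= opprD addrACA subrr addr0.
  - by have := near (j, lift ord0 ord0); rewrite /F /= opprD addrACA subrr addr0.
  - by have := near (j, lift ord0 (lift ord0 ord0)); rewrite /F /= opprD addrACA subrr addr0.
case/eqP: fg; apply/ffunP => i; apply: val_inj.
have rel : \prod_i u i ^ ((f i : nat)%:Z - (g i : nat)%:Z) = 1.
  rewrite (eq_bigr (fun i => u i ^+ f i / u i ^+ g i)) => [|k _].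
    by rewrite big_split /= prodfV -/(U f) -/(U g) Ufg divff.
  by rewrite expfzDr ?exprnN //; case: (uP k).
by have /eqP := indep _ rel i; rewrite subr_eq0 eqz_nat => /eqP.
Qed.

(** The bound [indep_units_le] yields a largest independent family, so [xget] returns a true maximum
    instead of its default 0. *)
Lemma unit_rank_ge : (#|reps S|.-1 <= unit_rank K)%N.
Proof.
have [u0 iu0] := exists_indep_units S.
pose P n := `[< exists u : 'I_n -> K, indep_units u >].
have exP : exists n, P n by exists #|reps S|.-1; apply/asboolP; exists u0.
have bP n : P n -> (n <= d)%N by move=> /asboolP[u /indep_units_le].
case: (ex_maxnP exP bP) => r /asboolP[ur iur] rmax.
rewrite /unit_rank; case: xgetP => [r' -> [_ maxr']|H].
  exact: maxr' iu0.
case: (H r); split; first by exists ur.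
by move=> n u iu; apply: rmax; apply/asboolP; exists u.
Qed.

End UnitRankBound.

(** * Gallagher's larger sieve *)

Section LargerSieve.
Variable R : realType.

(* Cauchy-Schwarz over the classes, in the form of a sum of squares. *)
Lemma collisions_ge (T Y : eqType) (s : seq T) (g : T -> Y) (nu : R) :
  s != [::] -> (size (undup (map g s)))%:R <= nu ->
  (size s)%:R ^+ 2 / nu <= \sum_(a <- s) \sum_(b <- s) (g a == g b)%:R.
Proof.
move=> s0; set F := undup _ => Fnu.
have uF : uniq F := undup_uniq _.
have nu0 : 0 < nu.
  apply: lt_le_trans Fnu; have [a sa] : exists a, a \in s.
    by case: s s0 {F uF} => // a s _; exists a; rewrite mem_head.
  by rewrite ltr0n (leq_ltn_trans (leq0n (index (g a) F))) // index_mem mem_undup map_f.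
pose m c : R := \sum_(a <- s) (g a == c)%:R.
have Fa a : a \in s -> g a \in F by move=> sa; rewrite mem_undup map_f.
have sum1 a (f : Y -> R) : a \in s -> \sum_(c <- F) (g a == c)%:R * f c = f (g a).
  move=> /Fa aF; rewrite (bigD1_seq (g a)) //= eqxx mul1r big1_seq ?addr0 // => c.
  by move=> /andP[/negbTE ca _]; rewrite eq_sym ca mul0r.
have sum_m : \sum_(c <- F) m c = (size s)%:R.
  rewrite exchange_big /= -count_predT -sum1_count natr_sum.
  apply: eq_big_seq => a sa; rewrite -[RHS](sum1 a (fun=> 1) sa).
  by apply: eq_bigr => c _; rewrite mulr1.
have sum_m2 : \sum_(c <- F) m c ^+ 2 = \sum_(a <- s) \sum_(b <- s) (g a == g b)%:R.
  transitivity (\sum_(a <- s) \sum_(c <- F) (g a == c)%:R * m c).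
    by rewrite exchange_big; apply: eq_bigr => c _; rewrite expr2 {1}/m mulr_suml.
  apply: eq_big_seq => a sa; rewrite sum1 // /m.
  by apply: eq_bigr => b _; rewrite eq_sym.
(* The size of each class if the elements were spread evenly over [nu] classes. Centering at [tau]
   gives the bound in terms of [nu] rather than of the actual number of classes. *)
pose tau := (size s)%:R / nu.
have : 0 <= \sum_(c <- F) (m c - tau) ^+ 2 by apply: sumr_ge0 => c _; apply: sqr_ge0.
have -> : \sum_(c <- F) (m c - tau) ^+ 2 =
    \sum_(c <- F) m c ^+ 2 - 2 * tau * \sum_(c <- F) m c + tau ^+ 2 * (size F)%:R.
  rewrite mulr_sumr -sumrB -[in RHS](mulr_natr) -[in RHS]count_predT -sum1_count natr_sum mulr_sumr -big_split.
  by apply: eq_bigr => c _ /=; ring.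
rewrite sum_m sum_m2 => h.
have h1 : tau ^+ 2 * (size F)%:R <= (size s)%:R ^+ 2 / nu.
  apply: (@le_trans _ _ (tau ^+ 2 * nu)); first by rewrite ler_wpM2l ?sqr_ge0.
  rewrite /tau le_eqVlt; apply/orP; left; apply/eqP; field; exact: lt0r_neq0.
have h2 : 2 * tau * (size s)%:R = 2 * ((size s)%:R ^+ 2 / nu).
  by rewrite /tau; field; exact: lt0r_neq0.
move: h h1; rewrite h2; move: (tau ^+ 2 * _) (_ / nu) (\sum_(a <- s) _) => a b e; lra.
Qed.

(** Weighted collisions are counted twice. By pairs, a diagonal pair contributes the full weight and
    any other at most [L]; by moduli, [collisions_ge] bounds each count below by n^2 / nu. *)
Lemma larger_sieve (X T Y : eqType) (P : seq X) (s : seq T) (g : X -> T -> Y)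
    (w nu : X -> R) (L : R) :
  uniq s -> s != [::] -> (forall p, p \in P -> 0 <= w p) ->
  (forall p, p \in P -> (size (undup (map (g p) s)))%:R <= nu p) ->
  (forall a b, a \in s -> b \in s -> a != b -> \sum_(p <- P | g p a == g p b) w p <= L) ->
  (size s)%:R * (\sum_(p <- P) w p / nu p - L) <= \sum_(p <- P) w p - L.
Proof.
move=> us s0 w0 gnu pairL.
pose n : R := (size s)%:R; pose W := \sum_(p <- P) w p.
have n0 : 0 < n by rewrite ltr0n lt0n size_eq0.
pose Z := \sum_(a <- s) \sum_(b <- s) \sum_(p <- P | g p a == g p b) w p.
have Z_le : Z <= n * (W + (n - 1) * L).
  have -> : n * (W + (n - 1) * L) = \sum_(a <- s) (W + (n - 1) * L).
    by rewrite big_const_seq count_predT iter_addr_0 mulr_natl.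
  rewrite /Z !big_seq; apply: ler_sum => a sa; rewrite (bigD1_seq a) //=.
  apply: lerD; first by under eq_bigl do rewrite eqxx.
  apply: (@le_trans _ _ (\sum_(b <- s | b != a) L)).
    rewrite big_seq_cond [leRHS]big_seq_cond; apply: ler_sum => b /andP[sb ba].
    by apply: pairL; rewrite // eq_sym.
  rewrite big_const_seq iter_addr_0 -mulr_natl.
  have -> // : (count (fun b => b != a) s)%:R = n - 1 :> R.
  have := count_predC (pred1 a) s; rewrite count_uniq_mem // sa /n => <-.
  by rewrite natrD addrAC subrr add0r.
have Z_ge : n ^+ 2 * \sum_(p <- P) w p / nu p <= Z.
  have -> : Z = \sum_(p <- P) w p * \sum_(a <- s) \sum_(b <- s) (g p a == g p b)%:R.
    rewrite /Z; under eq_bigr do under eq_bigr do rewrite big_mkcond.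
    under eq_bigr do rewrite exchange_big.
    rewrite exchange_big; apply: eq_bigr => p _; rewrite mulr_sumr.
    apply: eq_bigr => a _; rewrite mulr_sumr; apply: eq_bigr => b _.
    by case: eqP => _; rewrite ?mulr1 ?mulr0.
  rewrite mulr_sumr; rewrite !big_seq; apply: ler_sum => p pP.
  rewrite mulrCA; apply: ler_wpM2l; first exact: w0.
  by apply: collisions_ge => //; apply: gnu.
have h : n * (\sum_(p <- P) w p / nu p) <= W + (n - 1) * L.
  by rewrite -(ler_pM2l n0) mulrA -expr2 (le_trans Z_ge).
move: h; rewrite /W mulrBl mul1r mulrBr -/n.
by move: (n * _) (n * L) (\sum_(p <- P) w p) => a b e; lra.
Qed.

End LargerSieve.

(** * Boxes of bounded height *)

Section Boxes.
Variables (R : realType) (K : fieldExtType rat) (S : emb_system R K).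
Local Notation d := (deg S).
Local Notation OK := (ring_of_integers K).

Lemma ln_ideal_norm_ge0 (p : set OK) : 0 <= ln ((ideal_norm p)%:R : R).
Proof.
case: (ideal_norm p) => [|n]; first by rewrite ln0.
by rewrite ln_ge0 // ler1n.
Qed.

Lemma sum_ln_norm_le (P : seq (set OK)) (x : OK) (B : R) : uniq P ->
  (forall p, p \in P -> is_prime_ideal p) -> x != 0 ->
  (forall p, p \in P -> p x) -> normI S (int_val x) <= B ->
  \sum_(p <- P) ln ((ideal_norm p)%:R : R) <= ln B.
Proof.
move=> uP PP x0 Px xB.
(* A value 0 of [ideal_norm] contributes ln 0 = 0 to the sum but would annihilate the product, so
   such terms are set aside. *)
rewrite (bigID (fun p => 0 < ideal_norm p)%N) /= [X in _ + X]big1 ?addr0; last first.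
  by move=> p; rewrite -eqn0Ngt => /eqP ->; rewrite ln0.
rewrite -big_filter; set P' := [seq p <- P | (0 < ideal_norm p)%N].
have subP p : p \in P' -> p \in P by rewrite mem_filter => /andP[].
have pos p : p \in P' -> 0 < (ideal_norm p)%:R :> R.
  by rewrite mem_filter ltr0n => /andP[].
have prod_pos : 0 < (\prod_(p <- P') ideal_norm p)%:R :> R.
  by rewrite natr_prod big_seq; apply: prodr_gt0 => p; apply: pos.
have -> : \sum_(p <- P') ln ((ideal_norm p)%:R : R) = ln ((\prod_(p <- P') ideal_norm p)%:R).
  rewrite natr_prod; elim: P' pos {subP prod_pos} => [|p s IH] pos.
    by rewrite !big_nil ln1.
  have pos' q : q \in s -> 0 < (ideal_norm q)%:R :> R.
    by move=> qs; apply: pos; rewrite inE qs orbT.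
  rewrite !big_cons lnM ?posrE ?pos ?mem_head ?IH //.
  by rewrite big_seq; apply: prodr_gt0.
have le_prod : (\prod_(p <- P') ideal_norm p)%:R <= B.
  apply: le_trans xB; apply: prod_norm_le => // [|p /subP|p /subP]; last 2 first.
  - exact: PP.
  - exact: Px.
  by rewrite filter_uniq.
by rewrite ler_ln // posrE // (lt_le_trans prod_pos).
Qed.

Definition hgt (j : 'I_d) (x : K) : R := Num.max 1 (arch j x) ^+ fib j.

Lemma hgt_ge1 j x : 1 <= hgt j x.
Proof. by rewrite exprn_ege1 // le_max lexx. Qed.

Lemma prod_ge1 (I : finType) (Q : pred I) (f : I -> R) :
  (forall i, 1 <= f i) -> 1 <= \prod_(i | Q i) f i.
Proof.
move=> f1; apply: (big_ind (fun x => 1 <= x)) => // x y x1 y1.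
by rewrite -[1]mulr1 ler_pM.
Qed.

(** At each place |x - y| is at most twice the larger of max(1, |x|) and max(1, |y|). The
    multiplicities [fib] over [reps] add up to [d], whence 2^d. *)
Lemma normI_sub_le (b : 'I_d -> R) (x y : K) :
  (forall j, j \in reps S -> hgt j x <= b j /\ hgt j y <= b j) ->
  normI S (x - y) <= `|den S|%:~R ^+ d * 2 ^+ d * \prod_(j in reps S) b j.
Proof.
move=> xyb; rewrite /normI -mulrA ler_wpM2l ?exprn_ge0 //.
have archr k : arch (rep k) = arch k by exact: arch_rep.
rewrite -[X in X <= _](prod_reps (f := fun j => arch j (x - y))); last by move=> k; rewrite archr.
rewrite -[2 ^+ d]/(2 ^+ d); have -> : 2 ^+ d = \prod_(j in reps S) (2 : R) ^+ fib j.
  by rewrite (prod_reps (f := fun=> 2)) // prodr_const card_ord.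
rewrite -big_split; apply: ler_prod => j jr; rewrite exprn_ge0 ?arch_ge0 //=.
have [xb yb] := xyb j jr.
have le2 : arch j (x - y) <= 2 * Num.max (Num.max 1 (arch j x)) (Num.max 1 (arch j y)).
  apply: (@le_trans _ _ (arch j x + arch j y)).
    rewrite /arch /arch_abs rmorphB -[X in _ <= _ + X]cabsN; exact: cabsD.
  by rewrite mulr_natl mulr2n lerD // !le_max lexx ?orbT.
rewrite (@le_trans _ _ ((2 * Num.max (Num.max 1 (arch j x)) (Num.max 1 (arch j y))) ^+ fib j)) //.
  by rewrite lerXn2r ?nnegrE ?arch_ge0 // (le_trans _ le2) // arch_ge0.
rewrite exprMn ler_wpM2l ?exprn_ge0 //.
by case: (leP (Num.max 1 (arch j x))) => _.
Qed.

Lemma card_le_boxes (Key : finType) (T : eqType) (A : seq T) (key : T -> Key) (Q : R) :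
  0 <= Q -> (forall k, (size [seq a <- A | key a == k])%:R <= Q) ->
  (size A)%:R <= #|Key|%:R * Q.
Proof.
move=> Q0 AQ; have -> : (size A)%:R = \sum_k (size [seq a <- A | key a == k])%:R :> R.
  rewrite -natr_sum; congr _%:R.
  under eq_bigr do rewrite size_filter -sum1_count big_mkcond.
  rewrite exchange_big /= -[LHS]sum1_size; apply: eq_bigr => a _.
  by rewrite -big_mkcond (big_pred1 (key a)) // => k /=; rewrite eq_sym.
by rewrite mulr_natl -sumr_const; apply: ler_sum => k _; apply: AQ.
Qed.


(** The primes at which [a] and [b] collide all contain b - a, so the norm bound on differences
    supplies the pair bound ln B of the sieve. *)
Lemma separated_places_sieve (P : {fset set OK}) (s : seq OK) (nu : set OK -> R) (B : R) :
  uniq s -> s != [::] -> (forall p, p \in P -> is_prime_ideal p) ->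
  (forall p, p \in P -> (size (undup (map (residue_class p) s)))%:R <= nu p) ->
  (forall a b, a \in s -> b \in s -> normI S (int_val a - int_val b) <= B) ->
  (size s)%:R * (\sum_(p <- P) ln ((ideal_norm p)%:R : R) / nu p - ln B) <=
    \sum_(p <- P) ln ((ideal_norm p)%:R : R) - ln B.
Proof.
move=> us s0 PP snu sB; apply: (larger_sieve (P := enum_fset P) (g := @residue_class K)
  (w := fun p => ln ((ideal_norm p)%:R : R))) => //.
  by move=> p _; exact: ln_ideal_norm_ge0.
move=> a b sa sb ab; rewrite -big_filter.
apply: (@sum_ln_norm_le _ (b - a)); first by rewrite filter_uniq ?fset_uniq.
- by move=> p; rewrite mem_filter => /andP[_ /PP].
- by rewrite subr_eq0 eq_sym.
- move=> p; rewrite mem_filter => /andP[/eqP E /PP/prime_ideal[p0 _]].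
  have : residue_class p b b by rewrite /residue_class /= subrr.
  by rewrite -E.
- by rewrite rmorphB; exact: sB.
Qed.

Lemma height_ge_hgt (a : OK) : \prod_(j in reps S) hgt j (int_val a) <= height R (int_val a).
Proof. exact: height_ge. Qed.

(* The key omits the place [v0]: there the bound is what the height leaves over,
   which saves one power of [ln H]. *)
Lemma exists_boxes (H : R) (A : {fset OK}) : A != fset0 ->
  (forall a, a \in A -> height R (int_val a) <= H) ->
  exists (Key : finType) (key : OK -> Key),
    #|Key| = ((Num.truncn (ln H)).+1 ^ #|reps S|.-1)%N /\
    forall a b, a \in A -> b \in A -> key a = key b ->
      normI S (int_val a - int_val b) <= `|den S|%:~R ^+ d * 2 ^+ d * (expR 1 ^+ d * H).
Proof.
move=> /fset0Pn[a0 a0A] AH.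
pose v0 := rep (Ordinal (deg_gt0 S)).
pose X := (reps S :\ v0)%SET.
have v0r : v0 \in reps S by exact: rep_reps.
have cX : #|X| = #|reps S|.-1 by rewrite (cardsD1 v0 (reps S)) v0r.
pose T := Num.truncn (ln H).
pose kap (j : 'I_d) (a : OK) := Num.truncn (ln (hgt j (int_val a))).
have hgt0 (j : 'I_d) (a : OK) : 0 < hgt j (int_val a).
  by rewrite (lt_le_trans ltr01) ?hgt_ge1.
have lnhgt0 (j : 'I_d) (a : OK) : 0 <= ln (hgt j (int_val a)) by rewrite ln_ge0 ?hgt_ge1.
have hgtH (j : 'I_d) (a : OK) : a \in A -> j \in reps S -> hgt j (int_val a) <= H.
  move=> aA jr; apply: le_trans (AH _ aA); apply: le_trans (height_ge_hgt _).
  rewrite (bigD1 j) //=; apply: ler_peMr; first exact: ltW.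
  by apply: prod_ge1 => i; exact: hgt_ge1.
have H1 : 1 <= H by rewrite (le_trans (hgt_ge1 v0 (int_val a0))) // hgtH.
pose key (a : OK) : {ffun 'I_#|X| -> 'I_T.+1} := [ffun i => inord (kap (enum_val i) a)].
exists {ffun 'I_#|X| -> 'I_T.+1}, key; split; first by rewrite card_ffun !card_ord cX.
move=> a b aA bA keyE.
have kapT j c : c \in A -> j \in reps S -> (kap j c < T.+1)%N.
  move=> cA jr; rewrite ltnS; apply: le_truncn.
  by rewrite ler_ln ?posrE ?hgtH // (lt_le_trans ltr01).
have kapE j : j \in X -> kap j a = kap j b.
  move=> jX; have jr : j \in reps S by move: jX; rewrite in_setD1 => /andP[].
  have := congr1 (fun f : {ffun 'I_#|X| -> 'I_T.+1} => (f (enum_rank_in jX j) : nat)) keyE.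
  by rewrite !ffunE enum_rankK_in // !inordK ?kapT.
pose E := \prod_(j in X) expR (kap j a)%:R : R.
have E0 : 0 < E by apply: prodr_gt0 => j _; exact: expR_gt0.
(* The local heights away from [v0] multiply to at least [E], which leaves at most H / E at [v0].
   The product of all bounds is then H times one factor e for each rounded place. *)
pose bd (j : 'I_d) : R := if j == v0 then H / E else expR ((kap j a)%:R + 1).
have lower (j : 'I_d) c : expR (kap j c)%:R <= hgt j (int_val c).
  rewrite -[leRHS]lnK ?posrE // ler_expR.
  by have /andP[] := truncn_itv (lnhgt0 j c).
have upper (j : 'I_d) c : hgt j (int_val c) <= expR ((kap j c)%:R + 1).
  rewrite -[leLHS]lnK ?posrE // ler_expR ltW // natr1.
  by have /andP[] := truncn_itv (lnhgt0 j c).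
have v0bd c : c \in A -> (forall j, j \in X -> kap j a = kap j c) ->
    hgt v0 (int_val c) <= H / E.
  move=> cA kapc; rewrite ler_pdivlMr //; apply: le_trans (AH _ cA).
  apply: le_trans (height_ge_hgt _); rewrite (bigD1 v0) //=; apply: ler_wpM2l; first exact: ltW.
  rewrite (eq_bigl (mem X)) => [|j]; last by rewrite /= in_setD1 andbC.
  apply: ler_prod => j jX; rewrite ltW ?expR_gt0 //= kapc //.
have bdP c : c \in A -> (forall j, j \in X -> kap j a = kap j c) ->
    forall j, j \in reps S -> hgt j (int_val c) <= bd j.
  move=> cA kapc j jr; rewrite /bd; case: eqVneq => [->|jv]; first exact: v0bd.
  by rewrite kapc ?upper // in_setD1 jv.
apply: le_trans (normI_sub_le (b := bd) _) _.
  by move=> j jr; split; apply: bdP.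
rewrite ler_wpM2l ?mulr_ge0 ?exprn_ge0 //.
rewrite (bigD1 v0) //= {1}/bd eqxx (eq_bigl (mem X)) => [|j]; last first.
  by rewrite /= in_setD1 andbC.
have -> : \prod_(j in X) bd j = E * expR 1 ^+ #|X|.
  rewrite -prodr_const -big_split; apply: eq_bigr => j; rewrite in_setD1 => /andP[jv _].
  by rewrite /bd (negbTE jv) expRD.
rewrite mulrA divfK ?gt_eqF // mulrC ler_pM2r ?(lt_le_trans ltr01) //.
rewrite ler_weXn2l //; first by rewrite -expR0 ler_expR.
by rewrite (leq_trans (max_card _)) // card_ord.
Qed.

End Boxes.

(** For positive unit rank the right side vanishes at H = 1, where a nonempty [A] is still possible.
    [H0] keeps H away from 1 in that case; [c] depends on it, [CK] does not. *)
Theorem theorem1p1 (R : realType) (K : fieldExtType rat) :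
  exists CK : R, 0 < CK /\
  forall H0 : R, 1 < H0 ->
  exists c : R, 0 < c /\
  forall (H : R) (A : {fset ring_of_integers K})
    (P : {fset set (ring_of_integers K)})
    (nu : set (ring_of_integers K) -> R),
  0 < H ->
  ((0 < unit_rank K)%N -> H0 <= H) ->
  A != fset0 ->
  (forall a, a \in A -> height R (int_val a) <= H) ->
  (forall p, p \in P -> is_prime_ideal p) ->
  (forall p, p \in P -> (card_mod [set` A] p)%:R <= nu p) ->
  0 < \sum_(p <- P) ln ((ideal_norm p)%:R : R) / nu p - ln (2 * CK * H) ->
  (#|` A|)%:R <=
    c * ((\sum_(p <- P) ln ((ideal_norm p)%:R : R) - ln (2 * CK * H)) /
         (\sum_(p <- P) ln ((ideal_norm p)%:R : R) / nu p - ln (2 * CK * H)))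
      * ln H ^+ unit_rank K.
Proof.
have [S] := emb_system_ex R K.
(* CK H is the norm bound for differences inside one box, as given by [exists_boxes]. *)
pose CK : R := `|den S|%:~R ^+ deg S * 2 ^+ deg S * expR 1 ^+ deg S.
have CK0 : 0 < CK.
  by rewrite !mulr_gt0 ?exprn_gt0 ?expR_gt0 // ltr0z normr_gt0 den_neq0.
exists CK; split=> // H0 H01.
(* [k] absorbs the rounding in the number of boxes: ln H + 1 <= k ln H as soon as H >= H0. *)
pose r := unit_rank K; pose k := 1 + (ln H0)^-1.
have lnH0 : 0 < ln H0 by rewrite ln_gt0.
have k0 : 0 < k by rewrite addr_gt0 ?invr_gt0.
exists (k ^+ r); split; first by rewrite exprn_gt0.
move=> H A P nu Hgt0 HH0 A0 AH PP Anu.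
set L := ln (2 * CK * H); set V := \sum_(p <- P) _ / _; set W := \sum_(p <- P) _ => den0.
have [Key [key [cardKey keyP]]] := exists_boxes S A0 AH.
pose Q := (W - L) / (V - L).
pose box q := [seq a <- A | key a == q].
have boxA q a : a \in box q -> a \in A by rewrite mem_filter => /andP[].
have box_le q : box q != [::] -> (size (box q))%:R <= Q.
  move=> bk0; rewrite ler_pdivlMr // mulrC mulrC.
  apply: (separated_places_sieve (S := S) (B := 2 * CK * H)) => //.
  - by rewrite filter_uniq ?fset_uniq.
  - move=> p pP; apply: le_trans (Anu p pP); rewrite ler_nat /card_mod.
    apply: uniq_leq_size; first exact: undup_uniq.
    move=> c; rewrite mem_undup => /mapP[a /boxA aA ->].
    by rewrite in_fset_set ?inE; [exists a|apply: finite_image; exact: finite_fset].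
  - move=> a b; rewrite !mem_filter => /andP[/eqP ka aA] /andP[/eqP kb bA].
    apply: le_trans (keyP _ _ aA bA (etrans ka (esym kb))) _.
    rewrite mulrA -/CK -mulrA ler_peMl ?mulr_ge0 ?(ltW CK0) ?(ltW Hgt0) //.
    by rewrite ler1n.
have Q0 : 0 <= Q.
  have /fset0Pn[a aA] := A0.
  apply: le_trans (box_le (key a) _); first exact: ler0n.
  by rewrite -has_filter; apply/hasP; exists a.
have sizeA : (#|` A|)%:R <= #|Key|%:R * Q.
  apply: (card_le_boxes (key := key)) => // k'; rewrite -/(box k').
  have [->|] := eqVneq (box k') [::]; first by [].
  exact: box_le.
apply: le_trans sizeA _; rewrite [leRHS]mulrAC ler_wpM2r // -exprMn -/r cardKey natrX.
have H1 : 1 <= H.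
  have /fset0Pn[a aA] := A0; apply: le_trans (AH _ aA).
  apply: le_trans (height_ge_hgt S a); apply: prod_ge1 => j; exact: hgt_ge1.
have T1 : 1 <= (Num.truncn (ln H)).+1%:R :> R by rewrite ler1n.
apply: (@le_trans _ _ ((Num.truncn (ln H)).+1%:R ^+ r)).
  by rewrite ler_weXn2l // (unit_rank_ge S).
have [r0|r0] := posnP r; first by rewrite r0 !expr0.
have HH := HH0 r0.
have lnHH : ln H0 <= ln H by rewrite ler_ln ?posrE // (lt_trans ltr01).
have lnH1 : 0 <= ln H by rewrite ln_ge0.
rewrite lerXn2r ?nnegrE ?mulr_ge0 ?(ltW k0) //.
rewrite -natr1 /k mulrDl mul1r lerD //; first by have /andP[] := truncn_itv lnH1.
by rewrite mulrC ler_pdivlMr // mul1r.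
Qed.
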